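(* There are absolute constants $C_5 > 0$ and $c > 0$ with the following property. Let $n$ be a positive integer, let $K>0$ be a real number, and let $f : \mathbf{F}_2^n \to \mathbf{C}$ be a $1$-bounded function such that $\|f\|_{U^3(\mathbf{F}_2^n)} \geq 1/K$. Then there exists a quadratic polynomial $P : \mathbf{F}_2^n \to \mathbf{F}_2$ such that \[ \left| \frac{1}{2^n} \sum_{x \in \mathbf{F}_2^n} f(x) (-1)^{P(x)} \right| \geq c K^{-C_5}. \]
   Context: $\mathbf{F}_2$ is the field with two elements. A function $f$ is $1$-bounded if $|f(x)| \leq 1$ for all $x$. The Gowers uniformity norm $\|f\|_{U^3(\mathbf{F}_2^n)}$ is the non-negative real number defined by \[ \|f\|_{U^3(\mathbf{F}_2^n)}^8 = \frac{1}{2^{4n}} \sum_{x,h_1,h_2,h_3 \in \mathbf{F}_2^n} \ \prod_{\omega \in \{0,1\}^3} \mathcal{C}^{\omega_1+\omega_2+\omega_3} f(x + \omega_1 h_1 + \omega_2 h_2 + \omega_3 h_3), \] where $\mathcal{C}$ denotes complex conjugation. A quadratic polynomial $P:\mathbf{F}_2^n \to \mathbf{F}_2$ is a polynomial function of degree at most $2$ in the coordinates. The constants $c, C_5$ do not depend on $n,K,f$. *)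

(* Defs.v *)
From HB Require Import structures.
From mathcomp Require Import all_boot all_order all_algebra.
From mathcomp Require Import reals exp.
From mathcomp Require Import complex.
From mathcomp Require Import ring.
From mathcomp Require Import mpoly.

Set Implicit Arguments.
Unset Strict Implicit.
Unset Printing Implicit Defensive.

Import Order.TTheory GRing.Theory Num.Theory.

Local Open Scope complex_scope.
Local Open Scope ring_scope.

Definition bounded1 (R : realType) (n : nat) (f : 'rV['F_2]_n -> R[i]) : Prop :=
  forall x, `|f x| <= 1.

Definition gowersU3_avg (R : realType) (n : nat) (f : 'rV['F_2]_n -> R[i]) : R[i] :=
  (2 ^+ (4 * n))^-1 *
  \sum_(x : 'rV['F_2]_n) \sum_(h1 : 'rV['F_2]_n)
  \sum_(h2 : 'rV['F_2]_n) \sum_(h3 : 'rV['F_2]_n)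
    \prod_(w1 : bool) \prod_(w2 : bool) \prod_(w3 : bool)
      iter (w1 + w2 + w3) Num.conj
        (f (x + h1 *+ w1 + h2 *+ w2 + h3 *+ w3)).

(* [gowersU3_avg f] is a nonnegative real number, so taking its real part loses
   nothing: see [gowersU3_normX8] and [gowersU3_norm_ge0] below. *)
Definition gowersU3_norm (R : realType) (n : nat) (f : 'rV['F_2]_n -> R[i]) : R :=
  complex.Re (gowersU3_avg f) `^ (8%:R^-1).

Lemma gowersU3_avg_ge0 (R : realType) (n : nat) (f : 'rV['F_2]_n -> R[i]) :
  0 <= gowersU3_avg f.
Proof.
pose D h1 h2 x := f x * (f (x + h1))^* * (f (x + h2))^* * f (x + h1 + h2).
rewrite /gowersU3_avg mulr_ge0 ?invr_ge0 ?exprn_ge0 ?ler0n //.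
rewrite exchange_big sumr_ge0 //= => h1 _.
rewrite exchange_big sumr_ge0 //= => h2 _.
suff -> : \sum_x \sum_h3 \prod_(w1 : bool) \prod_(w2 : bool) \prod_(w3 : bool)
      iter (w1 + w2 + w3) Num.conj (f (x + h1 *+ w1 + h2 *+ w2 + h3 *+ w3))
    = (\sum_x D h1 h2 x) * (\sum_y D h1 h2 y)^* by exact: mul_conjC_ge0.
rewrite mulr_suml; apply: eq_bigr => x _.
rewrite rmorph_sum mulr_sumr (reindex_inj (addrI (- x))) /=.
apply: eq_bigr => y _.
rewrite !big_bool /= !mulr0n !mulr1n !addr0 /D !rmorphM /= !conjCK.
have E z : x + z + (- x + y) = y + z by rewrite addrACA addrN add0r addrC.
have -> : x + (- x + y) = y by rewrite addrA addrN add0r.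
have -> : x + h1 + h2 + (- x + y) = y + h1 + h2
  by rewrite -[x + h1 + h2]addrA E addrA.
rewrite !E; ring.
Qed.

Lemma gowersU3_norm_ge0 (R : realType) (n : nat) (f : 'rV['F_2]_n -> R[i]) :
  0 <= gowersU3_norm f.
Proof. exact: powR_ge0. Qed.

Lemma gowersU3_normX8 (R : realType) (n : nat) (f : 'rV['F_2]_n -> R[i]) :
  (gowersU3_norm f ^+ 8)%:C = gowersU3_avg f.
Proof.
have := gowersU3_avg_ge0 f; rewrite /gowersU3_norm.
case: (gowersU3_avg f) => a b; rewrite lecE /= => /andP[/eqP -> a0].
by rewrite -powR_mulrn ?powR_ge0 // -powRrM mulVf ?pnatr_eq0 // powRr1.
Qed.

(* [msize p] is one more than the total degree of [p], and [msize 0 = 0]. *)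
Definition quadratic_polynomial (n : nat) (P : 'rV['F_2]_n -> 'F_2) : Prop :=
  exists p : {mpoly 'F_2[n]},
    (msize p <= 3)%N /\ forall x, P x = p.@[fun i => x 0 i].

(* Main.v *)
(* For h, xi in V = F_2^n let q(h, xi) be the squared modulus of the Fourier
   coefficient at xi of x |-> f(x + h) conj(f(x)). As a function on V x V, q is
   nonnegative, at most 1, of total mass at most 2^n, and equal to its own
   (symplectic) Fourier transform; moreover sum q^2 = 2^n |f|_{U^3}^8.
   Self-duality turns the additive energy of the weight q into 4^n sum q^4, so a
   level set of q has large energy, and it forces q(c + H) <= q(H) for every
   subgroup H. The entropic Balog-Szemeredi-Gowers lemma extracts from the level
   set a set of small entropic doubling, and Marton's conjecture over F_2
   (Gowers, Green, Manners, Tao) gives a subgroup H of size about 2^n with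
   q(H) about 2^n, up to powers of K.
   Each fibre q(h, .) has mass at most 1, so H is close to the graph of a linear
   map M, and sum_h q(h, Mh) is large. By Cauchy-Schwarz M is symmetric on a
   large subspace W; removing the diagonal we may write M = B + B^T on W, and
   g(x) = f(x) (-1)^{Bx.x} then has large U^2 norm, hence a large Fourier
   coefficient. *)
Require Import Defs.
From HB Require Import structures.
From mathcomp Require Import all_boot all_order all_algebra.
From mathcomp Require Import reals sequences exp complex.
From mathcomp Require Import ring lra.
From mathcomp Require mpoly all_classical topology normedtype realfun derive.

Set Implicit Arguments.
Unset Strict Implicit.
Unset Printing Implicit Defensive.

Import Order.TTheory GRing.Theory Num.Theory.

Local Open Scope complex_scope.
Local Open Scope ring_scope.

(** * Characters of F_2^n and quadratic polynomials *)

Section Signs.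
Variable n : nat.
Local Notation V := 'rV['F_2]_n.

(** Every loss has to be a power of K, and such losses threaten wherever a coset has to be replaced
    by a subgroup. The bound q(c + H) <= q(H) makes these passages free: it is used for the coset
    that Marton's conjecture returns, for the translates of the graph of M that make up H, and for
    the translates of the graph of M over W. Marton's conjecture is proved by minimising one
    functional, not by iterating. At a minimiser the entropic Ruzsa distance of the two laws is
    zero, which makes the first of them uniform on a coset; comparing the minimum with the value at
    the given set then bounds the distance from the set to that coset. Symmetry of M does not
    suffice to write M = B + B^T, because in characteristic two B + B^T has zero diagonal. The
    diagonal form x -> Mx.x is however additive where M is symmetric, so making it vanish costs only
    a factor of two in the size of the subspace. *)

Definition dot (x y : V) : 'F_2 := (x *m y^T) 0 0.

Lemma dotDl x y z : dot (x + y) z = dot x z + dot y z.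
Proof. by rewrite /dot mulmxDl mxE. Qed.

Lemma dotDr x y z : dot z (x + y) = dot z x + dot z y.
Proof. by rewrite /dot linearD mulmxDr mxE. Qed.

Lemma dotC x y : dot x y = dot y x.
Proof. by rewrite /dot -[x *m y^T]trmxK trmx_mul trmxK mxE. Qed.

Lemma dotx0 x : dot x 0 = 0.
Proof. by rewrite /dot trmx0 mulmx0 mxE. Qed.

Lemma dot_mul (A : 'M_n) x y : dot (x *m A) y = dot x (y *m A^T).
Proof. by rewrite /dot trmx_mul trmxK mulmxA. Qed.

Lemma addFF (a : 'F_2) : a + a = 0.
Proof. by rewrite -mulr2n -mulr_natr pchar_Zp ?mulr0. Qed.

Lemma addVV p q (x : 'M['F_2]_(p, q)) : x + x = 0.
Proof. by apply/matrixP => i j; rewrite !mxE addFF. Qed.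

Lemma F2P (a : 'F_2) : a = 0 \/ a = 1.
Proof. by case: a => -[|[|//]] i; [left|right]; apply: val_inj. Qed.

Section Ring.
Variable T : numDomainType.

Definition sgn (a : 'F_2) : T := (-1) ^+ a.

Lemma sgn0 : sgn 0 = 1. Proof. by []. Qed.

Lemma sgnD a b : sgn (a + b) = sgn a * sgn b.
Proof.
by case: (F2P a) => ->; case: (F2P b) => ->;
  rewrite /sgn ?expr0 ?expr1 ?mulr1 ?mul1r ?mulrNN ?mulr1.
Qed.

Lemma sgnP a : sgn a = 1 \/ sgn a = -1.
Proof. by case: (F2P a) => ->; [left|right]. Qed.

Lemma sgn_sq a : sgn a * sgn a = 1.
Proof. by rewrite -sgnD addFF. Qed.

Lemma card_V : #|V|%:R = 2 ^+ n :> T.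
Proof. by rewrite card_mx card_Fp // mul1n natrX. Qed.

Lemma sum_sgn (k : V) : \sum_(x : V) sgn (dot x k) = if k == 0 then 2 ^+ n else 0.
Proof.
case: eqP => [->|/eqP k0].
  rewrite (eq_bigr (fun=> 1)) => [|x _].
    by rewrite sumr_const -card_V.
  by rewrite /dot trmx0 mulmx0 mxE.
have [y yk] : exists y, dot y k = 1.
  have [i ki] : exists i, k 0 i != 0.
    apply/existsP; apply: contraR k0; rewrite negb_exists => /forallP h.
    by apply/eqP/rowP => i; rewrite mxE; apply/eqP; have := h i; rewrite negbK.
  exists (delta_mx 0 i); rewrite dotC /dot trmx_delta -colE mxE.
  by case: (F2P (k 0 i)) => // h; rewrite h eqxx in ki.
have e : \sum_(x : V) sgn (dot x k) = - \sum_(x : V) sgn (dot x k).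
  rewrite {1}(reindex_inj (addIr y)) /= -sumrN; apply: eq_bigr => x _.
  by rewrite dotDl sgnD yk /sgn expr1 mulrN1.
by apply/eqP; rewrite -[_ == 0](mulrn_eq0 _ 2) mulr2n {1}e addNr.
Qed.

End Ring.
End Signs.

Module QuadraticPolynomial.
Import mpoly.

Section Poly.
Variable n : nat.
Local Notation V := 'rV['F_2]_n.

Lemma quadratic_polynomialP (B : 'M['F_2]_n) (xi : V) :
  quadratic_polynomial (fun x => dot (x *m B) x + dot x xi).
Proof.
pose X i : {mpoly 'F_2[n]} := 'X_i.
pose sz (p : {mpoly 'F_2[n]}) := msize p.
exists (\sum_i \sum_j B i j *: (X i * X j) + \sum_i xi 0 i *: X i); split.
  have szD (p r : {mpoly 'F_2[n]}) : (sz p <= 3)%N -> (sz r <= 3)%N -> (sz (p + r)%R <= 3)%N.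
    by move=> hp hr; apply: leq_trans (mmeasureD_le _ _ _) _; rewrite geq_max hp.
  have szZ c (p : {mpoly 'F_2[n]}) : (sz p <= 3)%N -> (sz (c *: p)%R <= 3)%N.
    by apply: leq_trans; exact: mmeasureZ_le.
  have szs (I : Type) (r : seq I) (F : I -> {mpoly 'F_2[n]}) :
      (forall i, (sz (F i) <= 3)%N) -> (sz (\sum_(i <- r) F i)%R <= 3)%N.
    move=> hF; apply: (big_ind (fun p => (sz p <= 3)%N)) => [|p r0|i _]; [|exact: szD|exact: hF].
    by rewrite /sz mmeasure0.
  apply: szD; apply: (szs) => i.
    apply: (szs) => j; apply: (szZ).
    by rewrite /X -mpolyXD /sz msizeX mdegD !mdeg1.
  by apply: szZ; rewrite /X /sz msizeX mdeg1.
move=> x; rewrite mevalD !raddf_sum /=; congr (_ + _).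
  rewrite /dot mxE (eq_bigr (fun j => \sum_i x 0 i * B i j * x 0 j)) => [|j _].
    rewrite exchange_big /=; apply: eq_bigr => i _; rewrite raddf_sum; apply: eq_bigr => j _.
    by rewrite /= mevalZ mevalM !mevalXU mulrCA mulrA.
  by rewrite !mxE mulr_suml.
rewrite /dot mxE; apply: eq_bigr => i _.
by rewrite mevalZ mevalXU mxE mulrC.
Qed.

End Poly.
End QuadraticPolynomial.

(** * Entropy on finite probability spaces *)

Section Entropy.
Variable R : realType.

Definition Nxlnx (x : R) : R := - (x * ln x).

Lemma Nxlnx0 : Nxlnx 0 = 0. Proof. by rewrite /Nxlnx mul0r oppr0. Qed.

Lemma ln_le_sub1 (x : R) : 0 < x -> ln x <= x - 1.
Proof.
move=> x0; have := @le_ln1Dx R (x - 1); rewrite addrCA subrr addr0; apply; lra.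
Qed.

(** With [x = s^2] one has [ln x = 2 ln s <= 2 (s - 1)], and [x - 1] exceeds this by [(s - 1)^2]. *)
Lemma ln_lt_sub1 (x : R) : 0 < x -> x != 1 -> ln x < x - 1.
Proof.
move=> x0 x1; rewrite lt_neqAle ln_le_sub1 // andbT; apply/negP => /eqP h.
have s0 : 0 < Num.sqrt x by rewrite sqrtr_gt0.
have sx : x = Num.sqrt x ^+ 2 by rewrite sqr_sqrtr // ltW.
have h1 := ln_le_sub1 s0.
have h2 : ln x = ln (Num.sqrt x) *+ 2 by rewrite {1}sx lnXn.
have h3 : (Num.sqrt x - 1) ^+ 2 <= 0.
  rewrite sqrrB1 -sx; have : x - 1 <= (Num.sqrt x - 1) *+ 2 by rewrite -h h2 lerMn2r h1 orbT.
  by rewrite mulrnBl => ?; lra.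
have : (Num.sqrt x - 1) ^+ 2 == 0 by rewrite eq_le h3 sqr_ge0.
rewrite sqrf_eq0 subr_eq0 => /eqP h4; move: x1; by rewrite sx h4 expr1n eqxx.
Qed.

(** A summand of relative entropy. The terms [- p + m] cancel once summed over two probability laws,
    and they make each summand non-negative, so that equality can be read off termwise. Absolute
    continuity has to be assumed since [ln 0 = 0]. *)
Lemma gibbs_pt (p m : R) : 0 <= p -> 0 <= m -> (m = 0 -> p = 0) ->
  0 <= p * ln p - p * ln m - p + m.
Proof.
rewrite le_eqVlt => /predU1P[<- m0 _|p0]; first by rewrite !mul0r; lra.
rewrite le_eqVlt => /predU1P[<- /(_ erefl)|m0 _]; first by lra.
have h := ln_le_sub1 (divr_gt0 m0 p0).
rewrite ln_div ?posrE // in h.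
have : p * (ln m - ln p) <= p * (m / p - 1) by rewrite ler_pM2l.
rewrite [X in _ <= X]mulrBr mulrCA divff ?gt_eqF //; lra.
Qed.

Lemma gibbs_pt_eq (p m : R) : 0 <= p -> 0 <= m -> (m = 0 -> p = 0) ->
  p * ln p - p * ln m - p + m = 0 -> p = m.
Proof.
rewrite le_eqVlt => /predU1P[<- m0 _|p0]; first by rewrite !mul0r; lra.
rewrite le_eqVlt => /predU1P[<- /(_ erefl)|m0 _]; first by lra.
move=> h0; apply/eqP; apply: contraT => pm.
have h := @ln_lt_sub1 (m / p) (divr_gt0 m0 p0).
have ne : m / p != 1.
  by apply: contra_neq pm => e; rewrite -[p]mul1r -e divfK // gt_eqF.
move/(_ ne): h; rewrite ln_div ?posrE // => h.
have : p * (ln m - ln p) < p * (m / p - 1) by rewrite ltr_pM2l.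
rewrite [X in _ < X]mulrBr mulrCA divff ?gt_eqF //; lra.
Qed.

Definition dist (T : finType) (p : T -> R) :=
  (forall x, 0 <= p x) /\ \sum_x p x = 1.

Section OneSpace.
Variables (O : finType) (p : O -> R).
Hypothesis dp : dist p.

Let p_ge0 w : 0 <= p w := dp.1 w.

Definition pr (T : eqType) (X : O -> T) (t : T) : R := \sum_(w | X w == t) p w.
Definition ent (T : finType) (X : O -> T) : R := \sum_t Nxlnx (pr X t).

Lemma pr_ge0 (T : eqType) (X : O -> T) t : 0 <= pr X t.
Proof. exact: sumr_ge0. Qed.

Lemma pr_gt0 (T : eqType) (X : O -> T) w : 0 < p w -> 0 < pr X (X w).
Proof.
move=> pw; rewrite /pr (bigD1 w) //=; apply: ltr_wpDr => //; exact: sumr_ge0.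
Qed.

Lemma sum_pr (T : finType) (X : O -> T) (g : T -> R) :
  \sum_t pr X t * g t = \sum_w p w * g (X w).
Proof.
rewrite [RHS](partition_big X predT) //=; apply: eq_bigr => t _.
by rewrite /pr mulr_suml; apply: eq_bigr => w /eqP ->.
Qed.

Lemma sum_pr1 (T : finType) (X : O -> T) : \sum_t pr X t = 1.
Proof.
rewrite -dp.2 -(eq_bigr _ (fun t _ => mulr1 (pr X t))) sum_pr.
by apply: eq_bigr => w _; rewrite mulr1.
Qed.

Lemma dist_pr (T : finType) (X : O -> T) : dist (pr X).
Proof. by split; [move=> t; apply: pr_ge0|apply: sum_pr1]. Qed.

(** As an expectation over the sample space, entropies of variables with different ranges can be
    compared point by point. *)
Lemma entE (T : finType) (X : O -> T) : ent X = - \sum_w p w * ln (pr X (X w)).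
Proof.
rewrite /ent -(sum_pr X (fun t => ln (pr X t))) -sumrN.
by apply: eq_bigr.
Qed.

Lemma ler_pr (T U : eqType) (X : O -> T) (Y : O -> U) w :
  (forall w', 0 < p w' -> X w' = X w -> Y w' = Y w) -> pr X (X w) <= pr Y (Y w).
Proof.
move=> h; rewrite /pr [leRHS]big_mkcond [leLHS]big_mkcond /=; apply: ler_sum => w' _.
have [->|pw] := eqVneq (p w') 0; first by do 2 case: ifP.
have pw0 : 0 < p w' by rewrite lt_neqAle eq_sym pw p_ge0.
case: eqP => [/(h _ pw0) ->|_]; first by rewrite eqxx.
by case: ifP.
Qed.

(** Up to null sets, the event [X = X w] lies in [Y = Y w]. The almost sure form matters for
    conditionally independent copies, whose relations hold only on the support of their law. *)
Lemma le_ent_as (T U : finType) (X : O -> T) (Y : O -> U) :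
  (forall w w', 0 < p w -> 0 < p w' -> X w = X w' -> Y w = Y w') -> ent Y <= ent X.
Proof.
move=> h; rewrite !entE lerN2; apply: ler_sum => w _.
have [->|pw] := eqVneq (p w) 0; first by rewrite !mul0r.
have pw0 : 0 < p w by rewrite lt_neqAle eq_sym pw p_ge0.
rewrite ler_pM2l // ler_ln ?posrE ?pr_gt0 //; apply: ler_pr => w' pw'; exact: h.
Qed.

Lemma le_ent (T U : finType) (X : O -> T) (Y : O -> U) :
  (forall w w', X w = X w' -> Y w = Y w') -> ent Y <= ent X.
Proof. by move=> h; apply: le_ent_as => w w' _ _; exact: h. Qed.

Lemma eq_ent (T U : finType) (X : O -> T) (Y : O -> U) :
  (forall w w', X w = X w' -> Y w = Y w') ->
  (forall w w', Y w = Y w' -> X w = X w') -> ent Y = ent X.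
Proof. by move=> h h'; apply/eqP; rewrite eq_le !le_ent. Qed.

Lemma ent_le_card (T : finType) (X : O -> T) (S : {set T}) :
  (forall w, 0 < p w -> X w \in S) -> ent X <= ln #|S|%:R.
Proof.
move=> h; have S0 : 0 < #|S|%:R :> R.
  rewrite ltr0n lt0n; apply/negP => /eqP/cards0_eq S0.
  have : \sum_w p w = 0; last by rewrite dp.2 => /eqP; rewrite oner_eq0.
  apply: big1 => w _; apply/eqP; rewrite eq_le p_ge0 andbT leNgt.
  by apply/negP => /h; rewrite S0 inE.
have -> : ln #|S|%:R = \sum_w p w * ln #|S|%:R by rewrite -mulr_suml dp.2 mul1r.
rewrite entE lerNl -sumrN.
rewrite -subr_ge0 -sumrB.
(* Jensen's inequality, in the form [ln y <= y - 1] at the inverse of [#|S| * pr X (X w)]. *)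
apply: (@le_trans _ _ (\sum_w p w * (1 - (#|S|%:R * pr X (X w))^-1))).
  rewrite (eq_bigr (fun w => p w - p w * (#|S|%:R * pr X (X w))^-1)); last first.
    by move=> w _; rewrite mulrBr mulr1.
  rewrite big_split /= dp.2 sumrN subr_ge0.
  rewrite -(sum_pr X (fun t => (#|S|%:R * pr X t)^-1)).
  rewrite (bigID (mem S)) /= [X in _ + X]big1 ?addr0; last first.
    move=> t tS; suff -> : pr X t = 0 by rewrite mul0r.
    apply: big1 => w /eqP e; apply/eqP; rewrite eq_le p_ge0 andbT leNgt.
    by apply/negP => /h; rewrite e (negbTE tS).
  apply: (@le_trans _ _ (\sum_(t in S) #|S|%:R^-1)); last first.
    by rewrite sumr_const -[_ *+ _]mulr_natr mulVf // gt_eqF.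
  apply: ler_sum => t _; rewrite invfM mulrCA.
  have [->|n0] := eqVneq (pr X t) 0; first by rewrite mul0r mulr0 invr_ge0 ltW.
  by rewrite divff // mulr1.
apply: ler_sum => w _.
have [->|pw] := eqVneq (p w) 0; first by rewrite !mul0r; lra.
have pw0 : 0 < p w by rewrite lt_neqAle eq_sym pw p_ge0.
rewrite -mulrN -mulrBr ler_pM2l // opprK.
have P0 := pr_gt0 X pw0; rewrite (addrC (ln _)) -lnM ?posrE //.
have M0 := mulr_gt0 S0 P0; have := ln_le_sub1 (_ : 0 < (#|S|%:R * pr X (X w))^-1).
rewrite invr_gt0 M0 lnV ?posrE // => /(_ isT); lra.
Qed.

(** This is I(X : Y | Z) >= 0. The function [g] below is the density, relative to the joint law, of
    the coupling in which X and Y are conditionally independent given Z; its mean is at most 1, and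
    [ln g <= g - 1]. *)
Lemma ent_submod (T U V : finType) (X : O -> T) (Y : O -> U) (Z : O -> V) :
  ent (fun w => (X w, Y w, Z w)) + ent Z <=
  ent (fun w => (X w, Z w)) + ent (fun w => (Y w, Z w)).
Proof.
set XYZ := fun w => _; set XZ := fun w => (X w, _); set YZ := fun w => (Y w, _).
rewrite !entE -!opprD lerN2 -!big_split /= -subr_ge0 -sumrB.
pose g (t : T * U * V) := pr XZ (t.1.1, t.2) * pr YZ (t.1.2, t.2) /
   (pr Z t.2 * pr XYZ t).
apply: (@le_trans _ _ (\sum_w p w * (1 - g (XYZ w)))); last first.
  apply: ler_sum => w _.
  have [->|pw] := eqVneq (p w) 0; first by rewrite !mul0r; lra.
  have pw0 : 0 < p w by rewrite lt_neqAle eq_sym pw p_ge0.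
  have h1 := pr_gt0 XZ pw0; have h2 := pr_gt0 YZ pw0.
  have h3 := pr_gt0 Z pw0; have h4 := pr_gt0 XYZ pw0.
  have hg : 0 < g (XYZ w) by rewrite divr_gt0 // mulr_gt0.
  rewrite -!mulrDr -mulrBr ler_pM2l //.
  have := ln_le_sub1 hg; rewrite /g /= ln_div ?posrE ?mulr_gt0 //.
  rewrite !lnM ?posrE //; lra.
rewrite (eq_bigr (fun w => p w - p w * g (XYZ w))); last first.
  by move=> w _; rewrite mulrBr mulr1.
rewrite sumrB dp.2 subr_ge0 -(sum_pr XYZ g).
have marg1 v : \sum_t pr XZ (t, v) = pr Z v.
  rewrite /pr (partition_big X predT) //=; apply: eq_bigr => t _.
  by apply: eq_bigl => w; rewrite xpair_eqE andbC.
have marg2 v : \sum_t pr YZ (t, v) = pr Z v.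
  rewrite /pr (partition_big Y predT) //=; apply: eq_bigr => t _.
  by apply: eq_bigl => w; rewrite xpair_eqE andbC.
apply: (@le_trans _ _ (\sum_(t : T * U * V) pr XZ (t.1.1, t.2) * pr YZ (t.1.2, t.2) / pr Z t.2)).
  apply: ler_sum => t _; rewrite /g.
  have [->|n0] := eqVneq (pr XYZ t) 0.
    by rewrite mul0r !mulr_ge0 ?invr_ge0 ?pr_ge0.
  by rewrite invfM (mulrA (_ * _) (pr Z _)^-1) mulrC divfK.
rewrite -(pair_bigA _ (fun a v => pr XZ (a.1, v) * pr YZ (a.2, v) / pr Z v)) /=.
rewrite exchange_big /= -(sum_pr1 Z); apply: ler_sum => v _.
rewrite -(pair_bigA _ (fun a b => pr XZ (a, v) * pr YZ (b, v) / pr Z v)) /=.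
rewrite (eq_bigr (fun a => pr XZ (a, v) * (pr Z v / pr Z v))); last first.
  by move=> a _; rewrite -mulr_suml -mulr_sumr marg2 mulrA.
rewrite -mulr_suml marg1.
have [->|n0] := eqVneq (pr Z v) 0; first by rewrite mul0r.
by rewrite divff // mulr1.
Qed.

Lemma ent_unit (X : O -> unit) : ent X = 0.
Proof.
rewrite entE big1 ?oppr0 // => w _.
have -> : pr X (X w) = 1; last by rewrite ln1 mulr0.
rewrite -dp.2; apply: eq_bigl => w'; by case: (X w'); case: (X w).
Qed.

Lemma ent_subadd (T U : finType) (X : O -> T) (Y : O -> U) :
  ent (fun w => (X w, Y w)) <= ent X + ent Y.
Proof.
have := ent_submod X Y (fun=> tt); rewrite ent_unit addr0.
rewrite (@eq_ent _ _ (fun w => (X w, Y w))); [|by move=> ?? [-> ->]|by move=> ?? [-> ->]].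
rewrite (@eq_ent _ _ X (fun w => (X w, tt))); [|by move=> ?? ->|by move=> ?? [->]].
by rewrite (@eq_ent _ _ Y (fun w => (Y w, tt))); [|by move=> ?? ->|by move=> ?? [->]].
Qed.

Definition indep (T U : finType) (X : O -> T) (Y : O -> U) :=
  forall x y, pr (fun w => (X w, Y w)) (x, y) = pr X x * pr Y y.

Lemma ent_indep (T U : finType) (X : O -> T) (Y : O -> U) :
  indep X Y -> ent (fun w => (X w, Y w)) = ent X + ent Y.
Proof.
move=> h; rewrite !entE -opprD -big_split /=; congr (- _); apply: eq_bigr => w _.
have [->|pw] := eqVneq (p w) 0; first by rewrite !mul0r addr0.
have pw0 : 0 < p w by rewrite lt_neqAle eq_sym pw p_ge0.
by rewrite h lnM ?posrE ?pr_gt0 // mulrDr.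
Qed.

Definition cindep (T U V : finType) (X : O -> T) (Y : O -> U) (Z : O -> V) :=
  forall x y z, pr (fun w => (X w, Y w, Z w)) (x, y, z) * pr Z z =
    pr (fun w => (X w, Z w)) (x, z) * pr (fun w => (Y w, Z w)) (y, z).

Lemma ent_cindep (T U V : finType) (X : O -> T) (Y : O -> U) (Z : O -> V) :
  cindep X Y Z -> ent (fun w => (X w, Y w, Z w)) + ent Z =
  ent (fun w => (X w, Z w)) + ent (fun w => (Y w, Z w)).
Proof.
move=> h; rewrite !entE -!opprD -!big_split /=; congr (- _); apply: eq_bigr => w _.
have [->|pw] := eqVneq (p w) 0; first by rewrite !mul0r addr0.
have pw0 : 0 < p w by rewrite lt_neqAle eq_sym pw p_ge0.
rewrite -!mulrDr -!lnM ?posrE ?(pr_gt0 _ pw0) //; first by rewrite h.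
Qed.

Lemma pr_comp (T U : finType) (X : O -> T) (f : T -> U) u :
  pr (fun w => f (X w)) u = \sum_(t | f t == u) pr X t.
Proof.
rewrite /pr (partition_big X (fun t => f t == u)) //=; apply: eq_bigr => t ft.
by apply: eq_bigl => w; case: (X w =P t) => [->|]; rewrite ?ft ?andbF.
Qed.

Lemma indep_comp (T U T' U' : finType) (X : O -> T) (Y : O -> U)
    (f : T -> T') (g : U -> U') :
  indep X Y -> indep (fun w => f (X w)) (fun w => g (Y w)).
Proof.
move=> h x y.
rewrite (pr_comp (fun w => (X w, Y w)) (fun a => (f a.1, g a.2))) !pr_comp.
rewrite big_distrl /=.
rewrite (eq_bigl (fun a : T * U => (f a.1 == x) && (g a.2 == y))); last first.
  by move=> a; rewrite xpair_eqE.
rewrite -(pair_big (fun a => f a == x) (fun b => g b == y)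
  (fun a b => pr (fun w => (X w, Y w)) (a, b))) /=.
by apply: eq_bigr => a _; rewrite mulr_sumr; apply: eq_bigr => b _.
Qed.

(* The junk value at an event of probability zero is the zero function. *)
Definition claw (T U : eqType) (X : O -> T) (Z : O -> U) (z : U) (x : T) : R :=
  pr (fun w => (X w, Z w)) (x, z) / pr Z z.

Lemma pr_pair_sum (T U : finType) (X : O -> T) (Z : O -> U) z :
  \sum_x pr (fun w => (X w, Z w)) (x, z) = pr Z z.
Proof.
rewrite /pr [RHS](partition_big X predT) //=; apply: eq_bigr => t _.
by apply: eq_bigl => w; rewrite xpair_eqE andbC.
Qed.

Lemma pr_pair_sumr (T U : finType) (X : O -> T) (Z : O -> U) x :
  \sum_z pr (fun w => (X w, Z w)) (x, z) = pr X x.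
Proof.
rewrite /pr [RHS](partition_big Z predT) //=; apply: eq_bigr => t _.
Qed.

Lemma pr_pair_le (T U : finType) (X : O -> T) (Z : O -> U) x z :
  pr (fun w => (X w, Z w)) (x, z) <= pr Z z.
Proof.
rewrite -(pr_pair_sum X Z) (bigD1 x) //= lerDl; apply: sumr_ge0 => *; exact: pr_ge0.
Qed.

Lemma dist_claw (T U : finType) (X : O -> T) (Z : O -> U) z :
  0 < pr Z z -> dist (claw X Z z).
Proof.
move=> h; split=> [x|]; first by rewrite divr_ge0 ?pr_ge0.
by rewrite -mulr_suml pr_pair_sum divff // gt_eqF.
Qed.

Lemma claw_mul (T U : finType) (X : O -> T) (Z : O -> U) z x :
  pr Z z * claw X Z z x = pr (fun w => (X w, Z w)) (x, z).
Proof.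
rewrite /claw mulrC; have [h|h] := eqVneq (pr Z z) 0; last by rewrite divfK.
by rewrite h mulr0; apply/eqP; rewrite eq_le pr_ge0 andTb -h pr_pair_le.
Qed.

(** The chain rule for the conditional entropy H(X | Z). *)
Lemma sum_Nxlnx_claw (T U : finType) (X : O -> T) (Z : O -> U) :
  \sum_z pr Z z * \sum_x Nxlnx (claw X Z z x) = ent (fun w => (X w, Z w)) - ent Z.
Proof.
rewrite [ent (fun w => _)]/ent -(pair_bigA _ (fun x z => Nxlnx (pr (fun w => (X w, Z w)) (x, z)))) /=.
rewrite exchange_big /= -sumrB; apply: eq_bigr => z _.
have [h|h] := eqVneq (pr Z z) 0.
  rewrite h mul0r Nxlnx0 subr0 big1 // => x _.
  by rewrite -claw_mul h mul0r Nxlnx0.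
have h0 : 0 < pr Z z by rewrite lt_neqAle eq_sym h pr_ge0.
have -> : Nxlnx (pr Z z) = - \sum_x pr (fun w => (X w, Z w)) (x, z) * ln (pr Z z).
  by rewrite -mulr_suml pr_pair_sum.
rewrite mulr_sumr opprK -big_split /=; apply: eq_bigr => x _.
rewrite -claw_mul /Nxlnx; set c := claw _ _ _ _.
have [->|c0] := eqVneq c 0; first by rewrite !(mulr0, mul0r, oppr0, addr0).
have cp : 0 < c by rewrite lt_neqAle eq_sym c0 divr_ge0 ?pr_ge0.
by rewrite lnM ?posrE //; ring.
Qed.

End OneSpace.
End Entropy.

(** * Convolutions and sumset inequalities *)

Section ProductLaw.
Variable R : realType.

Definition prodl (O1 O2 : finType) (p : O1 -> R) (q : O2 -> R) (w : O1 * O2) : R :=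
  p w.1 * q w.2.

Variables (O1 O2 : finType) (p : O1 -> R) (q : O2 -> R).
Hypotheses (dp : dist p) (dq : dist q).

Lemma dist_prodl : dist (prodl p q).
Proof.
split=> [w|]; first by rewrite mulr_ge0 // ?dp.1 ?dq.1.
rewrite -(pair_bigA _ (fun a b => p a * q b)) /= -dp.2.
by apply: eq_bigr => a _; rewrite -mulr_sumr dq.2 mulr1.
Qed.

Lemma pr_prodl (T U : eqType) (f : O1 -> T) (g : O2 -> U) x y :
  pr (prodl p q) (fun w => (f w.1, g w.2)) (x, y) = pr p f x * pr q g y.
Proof.
rewrite /pr (eq_bigl (fun w : O1 * O2 => (f w.1 == x) && (g w.2 == y))); last first.
  by move=> w; rewrite xpair_eqE.
rewrite -(pair_big (fun a => f a == x) (fun b => g b == y) (fun a b => p a * q b)) /=.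
by rewrite mulr_suml; apply: eq_bigr => a _; rewrite mulr_sumr.
Qed.

Lemma pr_prodl1 (T : finType) (f : O1 -> T) x :
  pr (prodl p q) (fun w => f w.1) x = pr p f x.
Proof.
rewrite -(pr_pair_sumr _ (fun w => f w.1) (fun w => w.2)).
rewrite (eq_bigr (fun z => pr p f x * pr q id z)) => [|z _]; last exact: pr_prodl.
by rewrite -mulr_sumr sum_pr1 // mulr1.
Qed.

Lemma pr_prodl2 (T : finType) (g : O2 -> T) y :
  pr (prodl p q) (fun w => g w.2) y = pr q g y.
Proof.
rewrite -(pr_pair_sum _ (fun w => w.1) (fun w => g w.2)).
rewrite (eq_bigr (fun z => pr p id z * pr q g y)) => [|z _]; last exact: (pr_prodl id).
by rewrite -mulr_suml sum_pr1 // mul1r.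
Qed.

Lemma indep_prodl (T U : finType) (f : O1 -> T) (g : O2 -> U) :
  indep (prodl p q) (fun w => f w.1) (fun w => g w.2).
Proof. by move=> x y; rewrite pr_prodl pr_prodl1 pr_prodl2. Qed.

Lemma ent_prodl1 (T : finType) (f : O1 -> T) :
  ent (prodl p q) (fun w => f w.1) = ent p f.
Proof. by apply: eq_bigr => x _; rewrite pr_prodl1. Qed.

Lemma ent_prodl2 (T : finType) (f : O2 -> T) :
  ent (prodl p q) (fun w => f w.2) = ent q f.
Proof. by apply: eq_bigr => x _; rewrite pr_prodl2. Qed.

End ProductLaw.

Section LawEntropy.
Variables (R : realType) (T : finType).
Implicit Types p q : T -> R.

Definition entl p : R := \sum_x Nxlnx (p x).

Lemma eq_entl p q : p =1 q -> entl p = entl q.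
Proof. by move=> h; apply: eq_bigr => x _; rewrite h. Qed.

Lemma pr_id p x : pr p id x = p x.
Proof. by rewrite /pr big_pred1_eq. Qed.

Lemma ent_id p : ent p id = entl p.
Proof. by apply: eq_bigr => x _; rewrite pr_id. Qed.

End LawEntropy.

Section Convolution.
Variables (R : realType) (G : finZmodType).
Implicit Types p q r : G -> R.

Definition conv p q (x : G) : R := \sum_y p y * q (x - y).

Lemma eq_conv p p' q q' : p =1 p' -> q =1 q' -> conv p q =1 conv p' q'.
Proof. by move=> h h' x; apply: eq_bigr => y _; rewrite h h'. Qed.

Lemma convC p q : conv p q =1 conv q p.
Proof.
move=> x; rewrite /conv (reindex_inj (inj_comp (addrI x) oppr_inj)) /=.
by apply: eq_bigr => y _; rewrite opprD opprK addrA subrr add0r mulrC.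
Qed.

Lemma convA p q r : conv (conv p q) r =1 conv p (conv q r).
Proof.
move=> x; rewrite /conv.
under eq_bigr do rewrite mulr_suml.
rewrite exchange_big /=; apply: eq_bigr => y _.
rewrite mulr_sumr (reindex_inj (addrI y)) /=; apply: eq_bigr => z _.
by rewrite mulrA addrAC subrr add0r opprD addrA.
Qed.

Lemma pr_add (O : finType) (p : O -> R) (X Y : O -> G) :
  indep p X Y -> pr p (fun w => X w + Y w) =1 conv (pr p X) (pr p Y).
Proof.
move=> h z; rewrite (pr_comp p (fun w => (X w, Y w)) (fun a => a.1 + a.2)).
rewrite -(pair_big_dep xpredT (fun a b => a + b == z)
  (fun a b => pr p (fun w => (X w, Y w)) (a, b))) /=.
apply: eq_bigr => x _; rewrite -h.
rewrite (eq_bigl (pred1 (z - x))) ?big_pred1_eq // => y.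
by rewrite /= addrC [LHS]eq_sym -subr_eq eq_sym.
Qed.

Lemma dist_conv p q : dist p -> dist q -> dist (conv p q).
Proof.
move=> dp dq; split=> [x|].
  by apply: sumr_ge0 => y _; rewrite mulr_ge0 ?dp.1 ?dq.1.
rewrite /conv exchange_big /= -dp.2; apply: eq_bigr => y _.
by rewrite -mulr_sumr (reindex_inj (addIr y)) /= (eq_bigr q) ?dq.2 ?mulr1 // => z _; rewrite addrK.
Qed.

Lemma ent_add (O : finType) (p : O -> R) (X Y : O -> G) :
  indep p X Y -> ent p (fun w => X w + Y w) = entl (conv (pr p X) (pr p Y)).
Proof. by move=> h; apply: eq_entl => x; exact: pr_add. Qed.

Lemma entl_conv_prodl p q : dist p -> dist q ->
  ent (prodl p q) (fun w => w.1 + w.2) = entl (conv p q).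
Proof.
move=> dp dq; rewrite ent_add; last exact: (indep_prodl dp dq id id).
apply: eq_entl; apply: eq_conv => x.
  by rewrite (pr_prodl1 p dq id) pr_id.
by rewrite (pr_prodl2 q dp id) pr_id.
Qed.

Lemma entl_convC p q : entl (conv p q) = entl (conv q p).
Proof. exact/eq_entl/convC. Qed.

(** Once the first summand is known, the sum retains the entropy of the second. *)
Lemma entl_conv_ge p q : dist p -> dist q -> entl q <= entl (conv p q).
Proof.
move=> dp dq; have d := dist_prodl dp dq; rewrite -entl_conv_prodl //.
have := ent_subadd d (fun w => w.1) (fun w => w.1 + w.2).
have := @le_ent _ _ _ d _ _ (fun w : G * G => (w.1, w.1 + w.2)) (fun w => (w.1, w.2)).
have -> : ent (prodl p q) (fun w => (w.1, w.2)) = entl p + entl q.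
  rewrite (ent_indep d (indep_prodl dp dq id id)) (ent_prodl1 p dq id).
  by rewrite (ent_prodl2 q dp id) !ent_id.
rewrite (ent_prodl1 p dq id) ent_id => /(_ _)/wrap[].
  by move=> [a b] [a' b'] /= [-> /addrI ->].
lra.
Qed.

(** The Kaimanovich-Vershik-Madiman inequality: submodularity of X and Z given X + Y + Z. Together,
    X, Z and the sum determine Y, while X and the sum amount to X and Y + Z, and Z and the sum to Z
    and X + Y. *)
Lemma entl_kvm p q r : dist p -> dist q -> dist r ->
  entl (conv (conv p q) r) + entl q <= entl (conv p q) + entl (conv q r).
Proof.
move=> dp dq dr; have dpq := dist_prodl dp dq; have d := dist_prodl dpq dr.
set P := prodl _ r in d.
pose X (w : G * G * G) := w.1.1; pose Y (w : G * G * G) := w.1.2.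
pose Z (w : G * G * G) := w.2.
have i1 : indep P (fun w => w.1) Z by exact: (indep_prodl dpq dr id id).
have prX : pr P X =1 p.
  by move=> x; rewrite (pr_prodl1 _ dr fst) (pr_prodl1 _ dq id) pr_id.
have prY : pr P Y =1 q.
  by move=> x; rewrite (pr_prodl1 _ dr snd) (pr_prodl2 _ dp id) pr_id.
have prZ : pr P Z =1 r by move=> x; rewrite (pr_prodl2 _ dpq id) pr_id.
have iXY : indep P X Y.
  move=> x y; rewrite prX prY (pr_prodl1 _ dr (fun a => (a.1, a.2))).
  by rewrite (pr_prodl p q id id) !pr_id.
have iYZ : indep P Y Z by exact: (indep_comp snd id i1).
have iXYZ : indep P (fun w => X w + Y w) Z by exact: (indep_comp (fun a => a.1 + a.2) id i1).
have eXY : ent P (fun w => X w + Y w) = entl (conv p q).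
  by rewrite ent_add //; apply/eq_entl/eq_conv.
have eYZ : ent P (fun w => Y w + Z w) = entl (conv q r).
  by rewrite ent_add //; apply/eq_entl/eq_conv.
have eXYZ : ent P (fun w => X w + Y w + Z w) = entl (conv (conv p q) r).
  rewrite ent_add //; apply/eq_entl/eq_conv => // x.
  by rewrite pr_add //; apply: eq_conv.
have eX : ent P X = entl p by exact: eq_entl.
have eY : ent P Y = entl q by exact: eq_entl.
have eZ : ent P Z = entl r by exact: eq_entl.
have := ent_submod d X Z (fun w => X w + Y w + Z w).
rewrite eXYZ.
have : ent P (fun w => (X w, X w + Y w + Z w)) <= entl p + entl (conv q r).
  rewrite -eX -eYZ; apply: le_trans (ent_subadd d _ _); apply: (le_ent d).
  by move=> w w' [-> e2]; rewrite -!addrA e2.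
have : ent P (fun w => (Z w, X w + Y w + Z w)) <= entl r + entl (conv p q).
  rewrite -eZ -eXY; apply: le_trans (ent_subadd d _ _); apply: (le_ent d).
  by move=> w w' [-> ->].
have : entl p + entl q + entl r <= ent P (fun w => (X w, Z w, X w + Y w + Z w)).
  rewrite -eX -eY -eZ -(ent_indep d iXY).
  rewrite -(ent_indep d (_ : indep P (fun w => (X w, Y w)) Z)); last first.
    exact: (indep_comp (fun a => (a.1, a.2)) id i1).
  by apply: (le_ent d) => w w' [-> ->] /addIr /addrI ->.
lra.
Qed.

(** Adding Y does not lower the entropy of X + Z, and [entl_kvm] bounds that of X + Y + Z. In
    characteristic two this is the triangle inequality for the entropic Ruzsa distance. *)
Lemma entl_triangle p q r : dist p -> dist q -> dist r ->
  entl (conv p r) + entl q <= entl (conv p q) + entl (conv q r).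
Proof.
move=> dp dq dr; apply: le_trans (entl_kvm dp dq dr).
rewrite lerD2r (eq_entl (convA p q r)).
rewrite (_ : entl (conv p (conv q r)) = entl (conv q (conv p r))).
  by apply: entl_conv_ge => //; apply: dist_conv.
rewrite -(eq_entl (convA q p r)) -(eq_entl (convA p q r)).
by apply/eq_entl/eq_conv => //; apply: convC.
Qed.

(** Under conditional independence, convolving the conditional laws gives the conditional law of X +
    Y, so both sides are H(X + Y | Z). *)
Lemma sum_conv_claw (O T : finType) (P : O -> R) (X Y : O -> G) (Z : O -> T) :
  dist P -> cindep P X Y Z ->
  \sum_z pr P Z z * entl (conv (claw P X Z z) (claw P Y Z z)) =
  ent P (fun w => (X w + Y w, Z w)) - ent P Z.
Proof.
move=> d h; rewrite -sum_Nxlnx_claw //; apply: eq_bigr => z _.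
have [->|z0] := eqVneq (pr P Z z) 0; first by rewrite !mul0r.
congr (_ * _); apply: eq_entl => x; rewrite /conv {3}/claw.
rewrite (pr_comp P (fun w => (X w, Y w, Z w)) (fun a => (a.1.1 + a.1.2, a.2))).
rewrite (eq_bigl (fun a : G * G * T => (a.1.1 + a.1.2 == x) && (a.2 == z))); last first.
  by move=> a; rewrite xpair_eqE.
rewrite -(pair_big (fun a : G * G => a.1 + a.2 == x) (fun b => b == z)
   (fun a b => pr P (fun w => (X w, Y w, Z w)) (a, b))) /=.
rewrite (eq_bigr (fun a => pr P (fun w => (X w, Y w, Z w)) (a, z))); last first.
  by move=> a _; rewrite big_pred1_eq.
rewrite -(pair_big_dep xpredT (fun a b => a + b == x)
  (fun a b => pr P (fun w => (X w, Y w, Z w)) (a, b, z))) /=.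
rewrite mulr_suml; apply: eq_bigr => y _.
rewrite (big_pred1 (x - y)) => [|y']; last first.
  by rewrite /= addrC [LHS]eq_sym -subr_eq eq_sym.
rewrite /claw mulrACA -h; field; exact: z0.
Qed.

(** Conditioning lowers entropy: the law of the sum with an independent variable is the mixture over
    [z] of its conditional versions, and entropy is concave. *)
Lemma entl_conv_claw_le (O T : finType) (P : O -> R) (X : O -> G) (Z : O -> T) q :
  dist P -> dist q ->
  \sum_z pr P Z z * entl (conv q (claw P X Z z)) <= entl (conv q (pr P X)).
Proof.
move=> d dq; rewrite /entl; under eq_bigr do rewrite mulr_sumr.
rewrite exchange_big /=; apply: ler_sum => x _.
set m := conv q (pr P X) x.
have mE : m = \sum_z pr P Z z * conv q (claw P X Z z) x.
  rewrite /conv; under eq_bigr do rewrite mulr_sumr.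
  rewrite exchange_big /=; apply: eq_bigr => y _.
  rewrite -(pr_pair_sumr P X Z) mulr_sumr; apply: eq_bigr => z _.
  by rewrite -claw_mul // mulrCA.
have c0 z : 0 <= conv q (claw P X Z z) x.
  apply: sumr_ge0 => y _; rewrite mulr_ge0 ?dq.1 // divr_ge0 ?pr_ge0 //; exact: d.1.
have m0 : 0 <= m by rewrite mE sumr_ge0 // => z _; rewrite mulr_ge0 // pr_ge0 //; exact: d.1.
(* The extra terms average to zero because [m] is the mean of the conditional values; they bring
   each summand into the form of [gibbs_pt]. *)
have -> : Nxlnx m = \sum_z pr P Z z * (- (conv q (claw P X Z z) x * ln m) + m - conv q (claw P X Z z) x).
  transitivity (\sum_z (pr P Z z * conv q (claw P X Z z) x * (- ln m - 1) + pr P Z z * m)).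
    by rewrite big_split /= -mulr_suml -mE -mulr_suml sum_pr1 // /Nxlnx; ring.
  by apply: eq_bigr => z _; ring.
apply: ler_sum => z _.
have [->|z0] := eqVneq (pr P Z z) 0; first by rewrite !mul0r.
have zp : 0 < pr P Z z by rewrite lt_neqAle eq_sym z0 pr_ge0 //; exact: d.1.
rewrite ler_pM2l //.
have := @gibbs_pt R _ m (c0 z) m0; rewrite /Nxlnx => /(_ _)/wrap[]; last by lra.
move=> me0; have := psumr_eq0P (_ : forall z, true -> 0 <= pr P Z z * conv q (claw P X Z z) x).
move=> /(_ _)/wrap[]; first by move=> z' _; rewrite mulr_ge0 // pr_ge0 //; exact: d.1.
rewrite -mE => /(_ me0 z isT)/eqP; rewrite mulf_eq0 (negbTE z0) /=; by move/eqP.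
Qed.

End Convolution.

(** * The entropic Balog-Szemeredi-Gowers lemma *)

Section Copies.
Variables (R : realType) (O T : finType) (p : O -> R) (Z : O -> T).
Hypothesis dp : dist p.

(** Joint law of two sample points sharing their value of [Z] and conditionally independent given
    it. Whole sample points are duplicated, so that any variable can be read off either copy. *)
Definition copies (w : O * O) : R :=
  if Z w.1 == Z w.2 then p w.1 * p w.2 / pr p Z (Z w.1) else 0.

Lemma pr_copies (U V : eqType) (f : O -> U) (g : O -> V) x y z :
  pr copies (fun w => (f w.1, g w.2, Z w.1)) (x, y, z) =
  pr p (fun w => (f w, Z w)) (x, z) * pr p (fun w => (g w, Z w)) (y, z) / pr p Z z.
Proof.
rewrite /pr mulr_suml mulr_suml big_mkcond /=.
rewrite [RHS]big_mkcond /= -(pair_bigA _ (fun a b =>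
  if (f a, g b, Z a) == (x, y, z) then copies (a, b) else 0)) /=.
apply: eq_bigr => a _; rewrite xpair_eqE; under eq_bigr do rewrite !xpair_eqE.
case: (f a =P x) => fa /=; last by rewrite big1.
case: (Z a =P z) => za; last by rewrite big1 // => b _; rewrite andbF.
rewrite mulr_sumr mulr_suml [RHS]big_mkcond /=; apply: eq_bigr => b _.
rewrite !xpair_eqE /copies /= za andbT.
by case: (g b =P y) => //= gb; rewrite eq_sym; case: (Z b =P z).
Qed.

Lemma pr_copies1 (U : finType) (f : O -> U) x z :
  pr copies (fun w => (f w.1, Z w.1)) (x, z) = pr p (fun w => (f w, Z w)) (x, z).
Proof.
rewrite (pr_comp copies (fun w => (f w.1, w.2, Z w.1)) (fun a => (a.1.1, a.2))).
rewrite (reindex (fun b => (x, b, z))) /=; last first.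
  exists (fun a => a.1.2) => [//|[[a b] c]]; rewrite inE /= => /eqP[-> ->]; done.
rewrite (eq_bigr (fun b => pr p (fun w => (f w, Z w)) (x, z) *
     pr p (fun w => (id w, Z w)) (b, z) / pr p Z z)) => [|b _]; last exact: pr_copies.
rewrite (eq_bigl xpredT) => [|b]; last by rewrite eqxx.
rewrite -mulr_suml -mulr_sumr pr_pair_sum.
have [z0|z0] := eqVneq (pr p Z z) 0; last by rewrite mulfK.
rewrite -claw_mul // z0; ring.
Qed.

Lemma pr_copies2 (U : finType) (g : O -> U) y z :
  pr copies (fun w => (g w.2, Z w.1)) (y, z) = pr p (fun w => (g w, Z w)) (y, z).
Proof.
rewrite (pr_comp copies (fun w => (w.1, g w.2, Z w.1)) (fun a => (a.1.2, a.2))).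
rewrite (reindex (fun b => (b, y, z))) /=; last first.
  exists (fun a => a.1.1) => [//|[[a b] c]]; rewrite inE /= => /eqP[-> ->]; done.
rewrite (eq_bigr (fun b => pr p (fun w => (id w, Z w)) (b, z) *
     pr p (fun w => (g w, Z w)) (y, z) / pr p Z z)) => [|b _]; last exact: pr_copies.
rewrite (eq_bigl xpredT) => [|b]; last by rewrite eqxx.
rewrite -mulr_suml -mulr_suml pr_pair_sum.
have [z0|z0] := eqVneq (pr p Z z) 0; last by rewrite mulrC mulKf.
rewrite -claw_mul // z0; ring.
Qed.

Lemma pr_copiesZ z : pr copies (fun w => Z w.1) z = pr p Z z.
Proof.
rewrite -(pr_pair_sum _ (fun w => w.1)) -(pr_pair_sum _ id).
by apply: eq_bigr => x _; exact: (pr_copies1 id).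
Qed.

Lemma dist_copies : dist copies.
Proof.
split=> [w|].
  rewrite /copies; case: eqP => // _; rewrite divr_ge0 ?mulr_ge0 ?pr_ge0 //; exact: dp.1.
transitivity (\sum_z pr copies (fun w => Z w.1) z).
  rewrite -[RHS](eq_bigr _ (fun z _ => mulr1 _)) sum_pr.
  by apply: eq_bigr => w _; rewrite mulr1.
by rewrite -(sum_pr1 dp Z); apply: eq_bigr => z _; exact: pr_copiesZ.
Qed.

Lemma cindep_copies (U V : finType) (f : O -> U) (g : O -> V) :
  cindep copies (fun w => f w.1) (fun w => g w.2) (fun w => Z w.1).
Proof.
move=> x y z; rewrite pr_copies pr_copiesZ pr_copies1 pr_copies2.
have [z0|z0] := eqVneq (pr p Z z) 0; last by rewrite divfK.
by rewrite -claw_mul // z0; ring.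
Qed.

Lemma copies_eq w : 0 < copies w -> Z w.1 = Z w.2.
Proof. by rewrite /copies; case: eqP => //; rewrite ltxx. Qed.

End Copies.

Section EntropicBSG.
Variables (R : realType) (G : finZmodType).
Hypothesis char2 : forall x : G, x + x = 0.

(* Two conditionally independent copies of (A, B) given (A + B, S) satisfy
   A1 + B2 = B1 + A2; submodularity does the rest. *)
Lemma entropic_bsg (O T : finType) (p : O -> R) (A B : O -> G) (S : O -> T) :
  dist p ->
  let Z w := (A w + B w, S w) in is_true (
  \sum_z pr p Z z * entl (conv (claw p A Z z) (claw p B Z z)) <=
  2 * (ent p (fun w => (A w, S w)) + ent p (fun w => (B w, S w))) - 3 * ent p S
  - 2 * ent p (fun w => (A w, B w, S w)) + ent p Z).
Proof.
move=> dp Z.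
pose q := copies p Z; have dq : dist q by exact: dist_copies.
pose Zq (w : O * O) := Z w.1; pose Sq (w : O * O) := S w.1.
pose A1 (w : O * O) := A w.1; pose B1 (w : O * O) := B w.1.
pose A2 (w : O * O) := A w.2; pose B2 (w : O * O) := B w.2.
have ci : cindep q A1 B2 Zq := @cindep_copies R O _ p Z dp G G A B.
have eZ : ent q Zq = ent p Z by apply: eq_bigr => z _; rewrite pr_copiesZ.
have e1 (U : finType) (f : O -> U) :
    ent q (fun w => (f w.1, Zq w)) = ent p (fun w => (f w, Z w)).
  by apply: eq_bigr => -[x z] _; rewrite pr_copies1.
have e2 (U : finType) (f : O -> U) :
    ent q (fun w => (f w.2, Zq w)) = ent p (fun w => (f w, Z w)).
  by apply: eq_bigr => -[x z] _; rewrite pr_copies2.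
have f1 (U : finType) (f : O -> U) : ent q (fun w => f w.1) = ent p f.
  apply: eq_bigr => x _; congr Nxlnx.
  by rewrite -(pr_pair_sumr q _ Zq) -(pr_pair_sumr p _ Z); apply: eq_bigr => z _; rewrite pr_copies1.
have f2 (U : finType) (f : O -> U) : ent q (fun w => f w.2) = ent p f.
  apply: eq_bigr => x _; congr Nxlnx.
  by rewrite -(pr_pair_sumr q _ Zq) -(pr_pair_sumr p _ Z); apply: eq_bigr => z _; rewrite pr_copies2.
have rel w : 0 < q w -> A w.1 + B w.1 = A w.2 + B w.2 /\ S w.1 = S w.2.
  by move/copies_eq => [-> ->].
have relAB w : 0 < q w -> A1 w + B2 w = B1 w + A2 w.
  move=> /rel[e _]; apply/eqP; rewrite -subr_eq0 /A1 /B2 /B1 /A2.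
  have opp_char2 (x : G) : - x = x by apply/esym/eqP; rewrite -subr_eq0 opprK char2.
  by rewrite opprD !opp_char2 addrACA e [B _ + A _]addrC char2.
(* Given [Z], the variable [B2] has the law of [B] and is independent of [A1]; the average is
   therefore H(A1 + B2 | Z). *)
have -> : \sum_z pr p Z z * entl (conv (claw p A Z z) (claw p B Z z)) =
          \sum_z pr q Zq z * entl (conv (claw q A1 Zq z) (claw q B2 Zq z)).
  apply: eq_bigr => z _; rewrite pr_copiesZ //; congr (_ * _).
  apply/eq_entl/eq_conv => x; rewrite /claw pr_copiesZ //.
    by rewrite pr_copies1.
  by rewrite pr_copies2.
rewrite sum_conv_claw // eZ.
pose D w := (A w, B w, S w).
(* Conditional independence gives equality up to the entropy of [Z], which [D] determines. *)
have H1 : 2 * ent p D - ent p Z <= ent q (fun w => (D w.1, D w.2)).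
  have := ent_cindep dq (@cindep_copies R O _ p Z dp _ _ D D).
  rewrite e1 e2 eZ.
  have -> : ent p (fun w => (D w, Z w)) = ent p D.
    apply: (eq_ent dp) => w w'; last by move/(congr1 fst).
    by rewrite /D /Z => -[-> -> ->].
  have : ent q (fun w => (D w.1, D w.2, Zq w)) <= ent q (fun w => (D w.1, D w.2)).
    by apply: (le_ent dq) => w w'; rewrite /Zq /Z /D => -[-> -> -> -> -> ->].
  lra.
have H2 := ent_submod dq (fun w => A1 w + B2 w) (fun w => A w.1 + B w.1) Sq.
have H2a : ent q (fun w => (A1 w + B2 w, Zq w)) <=
    ent q (fun w => (A1 w + B2 w, A w.1 + B w.1, Sq w)).
  by apply: (le_ent dq) => w w' [-> e3 e4]; rewrite /Sq in e4; rewrite /Zq /Z e3 e4.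
have eS : ent q Sq = ent p S by exact: f1.
have eZ' : ent q (fun w => (A w.1 + B w.1, Sq w)) = ent p Z by exact: eZ.
have H3 := ent_submod dq A1 B1 (fun w => (A1 w + B2 w, Sq w)).
(* [A1] and [A1 + B2] give [B2]; the relation between the copies then gives [A2]. In the final count
   the entropy of [(A1 + B2, S)] cancels between [H2] and [H3]. *)
have H3a : ent q (fun w => (D w.1, D w.2)) <=
    ent q (fun w => (A1 w, B1 w, (A1 w + B2 w, Sq w))).
  apply: (le_ent_as dq) => w w' w0 w0' [eA eB eAB eS'].
  have eB2 : B2 w = B2 w' by move: eAB; rewrite eA => /addrI.
  have eA2 : A2 w = A2 w' by move: eAB; rewrite !relAB // eB => /addrI.
  have s1 := (rel _ w0).2; have s2 := (rel _ w0').2.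
  rewrite /D; move: eA eB eS' eA2 eB2; rewrite /A1 /B1 /A2 /B2 /Sq -s1 -s2.
  by move=> -> -> -> -> ->.
have H4 : ent q (fun w => (A1 w, (A1 w + B2 w, Sq w))) <=
   ent p (fun w => (A w, S w)) + ent p (fun w => (B w, S w)) - ent p S.
  have h := ent_submod dq A1 B2 Sq.
  have h1 : ent q (fun w => (A1 w, Sq w)) = ent p (fun w => (A w, S w)) by exact: f1.
  have h2 : ent q (fun w => (B2 w, Sq w)) <= ent p (fun w => (B w, S w)).
    rewrite -f2; apply: (le_ent_as dq) => w w' w0 w0' /=.
    by rewrite /Sq (rel _ w0).2 (rel _ w0').2.
  have h3 : ent q (fun w => (A1 w, (A1 w + B2 w, Sq w))) <= ent q (fun w => (A1 w, B2 w, Sq w)).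
    by apply: (le_ent dq) => w w' [-> -> ->].
  by move: h; rewrite h1 eS; lra.
have H5 : ent q (fun w => (B1 w, (A1 w + B2 w, Sq w))) <=
   ent p (fun w => (A w, S w)) + ent p (fun w => (B w, S w)) - ent p S.
  have h := ent_submod dq B1 A2 Sq.
  have h1 : ent q (fun w => (B1 w, Sq w)) = ent p (fun w => (B w, S w)) by exact: f1.
  have h2 : ent q (fun w => (A2 w, Sq w)) <= ent p (fun w => (A w, S w)).
    rewrite -f2; apply: (le_ent_as dq) => w w' w0 w0' /=.
    by rewrite /Sq (rel _ w0).2 (rel _ w0').2.
  have h3 : ent q (fun w => (B1 w, (A1 w + B2 w, Sq w))) <= ent q (fun w => (B1 w, A2 w, Sq w)).
    by apply: (le_ent_as dq) => w w' w0 w0'; rewrite !relAB // => -[-> -> ->].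
  by move: h; rewrite h1 eS; lra.
by move: H2 H3; rewrite eS eZ' -/D; lra.
Qed.

End EntropicBSG.

(** * Marton's conjecture over F_2 *)

Section Minimizer.
Variables (R : realType) (G : finZmodType).
Hypothesis char2 : forall x : G, x + x = 0.
Variable p0 : G -> R.

(* Up to an additive constant depending on [p0] only, this is
   d[p; q] + (d[p0; p] + d[p0; q]) / 20, with d the entropic Ruzsa distance. *)
Definition tau (p q : G -> R) : R :=
  entl (conv p q) - 21 / 40 * (entl p + entl q) + 1 / 20 * (entl (conv p0 p) + entl (conv p0 q)).

Hypothesis dp0 : dist p0.
Variables p1 p2 : G -> R.
Hypotheses (dp1 : dist p1) (dp2 : dist p2).
Hypothesis tau_min : forall q1 q2, dist q1 -> dist q2 -> tau p1 p2 <= tau q1 q2.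

(** Minimality is applied to the two conditional laws at each [z] of positive probability and
    averaged. The terms with [p0] can only grow when the conditioning is dropped. *)
Lemma tau_min_cond (O T : finType) (P : O -> R) (X Y : O -> G) (Z : O -> T) :
  dist P -> tau p1 p2 <=
  \sum_z pr P Z z * entl (conv (claw P X Z z) (claw P Y Z z))
  - 21 / 40 * (ent P (fun w => (X w, Z w)) + ent P (fun w => (Y w, Z w)) - 2 * ent P Z)
  + 1 / 20 * (entl (conv p0 (pr P X)) + entl (conv p0 (pr P Y))).
Proof.
move=> d.
have h : tau p1 p2 <= \sum_z pr P Z z * tau (claw P X Z z) (claw P Y Z z).
  rewrite -[leLHS]mul1r -(sum_pr1 d Z) mulr_suml; apply: ler_sum => z _.
  have [->|z0] := eqVneq (pr P Z z) 0; first by rewrite !mul0r.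
  have zp : 0 < pr P Z z by rewrite lt_neqAle eq_sym z0 pr_ge0 //; exact: d.1.
  by rewrite ler_pM2l //; apply: tau_min; exact: dist_claw.
apply: (le_trans h).
have hX := entl_conv_claw_le X Z d dp0; have hY := entl_conv_claw_le Y Z d dp0.
have eX := sum_Nxlnx_claw d X Z; have eY := sum_Nxlnx_claw d Y Z.
have -> : \sum_z pr P Z z * tau (claw P X Z z) (claw P Y Z z) =
   \sum_z pr P Z z * entl (conv (claw P X Z z) (claw P Y Z z))
   - 21 / 40 * (\sum_z pr P Z z * entl (claw P X Z z) + \sum_z pr P Z z * entl (claw P Y Z z))
   + 1 / 20 * (\sum_z pr P Z z * entl (conv p0 (claw P X Z z))
             + \sum_z pr P Z z * entl (conv p0 (claw P Y Z z))).
  rewrite -!big_split /= !mulr_sumr -sumrN -!big_split /=.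
  by apply: eq_bigr => z _; rewrite /tau; ring.
rewrite {2}/entl {2}/entl eX eY; lra.
Qed.

(* With X1, X1', X2, X2' independent, V = X1' + X2, W = X1' + X1 and S their sum,
   minimality at the pairs (X2 + X2', X1 + X1') and (X2, X1') conditioned on these
   sums bounds I(V : W | S). As U = V + W, conditioning V and W on (U, S) then gives,
   by the entropic Balog-Szemeredi-Gowers inequality, a pair whose [tau] would be
   too small unless the Ruzsa distance k of p1 and p2 satisfies k <= 17/20 k. *)
Lemma tau_min_doubling : 2 * entl (conv p1 p2) <= entl p1 + entl p2.
Proof.
pose a := entl p1; pose b := entl p2; pose s := entl (conv p1 p2).
pose e := entl (conv p1 p1); pose f := entl (conv p2 p2).
pose u := entl (conv p0 p1); pose v := entl (conv p0 p2).
have d11 := dist_prodl dp1 dp1; have d22 := dist_prodl dp2 dp2.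
have d := dist_prodl d11 d22.
set P := prodl _ _ in d.
pose X1 (w : (G * G) * (G * G)) := w.1.1; pose X1' (w : (G * G) * (G * G)) := w.1.2.
pose X2 (w : (G * G) * (G * G)) := w.2.1; pose X2' (w : (G * G) * (G * G)) := w.2.2.
have ind (T U : finType) (g : G * G -> T) (h : G * G -> U) :
    indep P (fun w => g w.1) (fun w => h w.2) by exact: indep_prodl.
have i1 (T U : finType) (g : G -> T) (h : G -> U) :
    indep P (fun w => g (X1 w)) (fun w => h (X1' w)).
  move=> x y; rewrite (pr_prodl1 _ d22 (fun a => (g a.1, h a.2))).
  rewrite (pr_prodl1 _ d22 (fun a => g a.1)) (pr_prodl1 _ d22 (fun a => h a.2)).
  exact: (indep_prodl dp1 dp1 g h).
have i2 (T U : finType) (g : G -> T) (h : G -> U) :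
    indep P (fun w => g (X2 w)) (fun w => h (X2' w)).
  move=> x y; rewrite (pr_prodl2 _ d11 (fun a => (g a.1, h a.2))).
  rewrite (pr_prodl2 _ d11 (fun a => g a.1)) (pr_prodl2 _ d11 (fun a => h a.2)).
  exact: (indep_prodl dp2 dp2 g h).
have pX1 : pr P X1 =1 p1.
  by move=> x; rewrite (pr_prodl1 _ d22 fst) (pr_prodl1 _ dp1 id) pr_id.
have pX1' : pr P X1' =1 p1.
  by move=> x; rewrite (pr_prodl1 _ d22 snd) (pr_prodl2 _ dp1 id) pr_id.
have pX2 : pr P X2 =1 p2.
  by move=> x; rewrite (pr_prodl2 _ d11 fst) (pr_prodl1 _ dp2 id) pr_id.
have pX2' : pr P X2' =1 p2.
  by move=> x; rewrite (pr_prodl2 _ d11 snd) (pr_prodl2 _ dp2 id) pr_id.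
pose U w := X1 w + X2 w; pose V w := X1' w + X2 w; pose W w := X1' w + X1 w.
pose W2 w := X2 w + X2' w; pose S w := X1 w + X1' w + (X2 w + X2' w).
pose t := ent P S; pose J := ent P (fun w => (V w, W w, S w)).
have pU : pr P U =1 conv p1 p2.
  by move=> x; rewrite pr_add; [apply: eq_conv|exact: (ind _ _ fst fst)].
have pV : pr P V =1 conv p1 p2.
  by move=> x; rewrite pr_add; [apply: eq_conv|exact: (ind _ _ snd fst)].
have pW : pr P W =1 conv p1 p1.
  move=> x; rewrite -(_ : pr P (fun w => X1 w + X1' w) x = pr P W x).
    by rewrite pr_add; [apply: eq_conv|exact: (i1 _ _ id id)].
  by apply: eq_bigl => w; rewrite /W addrC.
have pW2 : pr P W2 =1 conv p2 p2.
  by move=> x; rewrite pr_add; [apply: eq_conv|exact: (i2 _ _ id id)].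
have pS : pr P S =1 conv (conv p2 p2) (conv p1 p1).
  move=> x; rewrite convC pr_add; last exact: (ind _ _ (fun a => a.1 + a.2) (fun a => a.1 + a.2)).
  apply: eq_conv => // y; rewrite pr_add; [by apply: eq_conv|exact: (i1 _ _ id id)].
have eX1 : ent P X1 = a by exact: eq_entl.
have eX1' : ent P X1' = a by exact: eq_entl.
have eX2 : ent P X2 = b by exact: eq_entl.
have eX2' : ent P X2' = b by exact: eq_entl.
have eU : ent P U = s by exact: eq_entl.
have eV : ent P V = s by exact: eq_entl.
have eW : ent P W = e by exact: eq_entl.
have eW2 : ent P W2 = f by exact: eq_entl.
have d12 := dist_conv dp1 dp2.
have de := dist_conv dp1 dp1; have df := dist_conv dp2 dp2.
have Fval : tau p1 p2 = s - 21 / 40 * (a + b) + 1 / 20 * (u + v) by [].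
(* When [m1] and [m2] are added, the terms with [p0] cancel and [2 s <= e + f] remains. *)
have m1 : tau p1 p2 <= e - 21 / 40 * (a + a) + 1 / 20 * (u + u) by exact: tau_min.
have m2 : tau p1 p2 <= f - 21 / 40 * (b + b) + 1 / 20 * (v + v) by exact: tau_min.
have m3 : tau p1 p2 <= t - 21 / 40 * (f + e)
    + 1 / 20 * (entl (conv p0 (conv p2 p2)) + entl (conv p0 (conv p1 p1))).
  rewrite /t (_ : ent P S = entl (conv (conv p2 p2) (conv p1 p1))); last exact: eq_entl.
  exact: tau_min.
have k1 : entl (conv p0 (conv p1 p1)) + a <= u + e.
  by rewrite -(eq_entl (convA p0 p1 p1)); exact: entl_kvm.
have k2 : entl (conv p0 (conv p2 p2)) + b <= v + f.
  by rewrite -(eq_entl (convA p0 p2 p2)); exact: entl_kvm.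
have k3 : entl (conv p0 (conv p1 p2)) + b <= v + s.
  rewrite /s (entl_convC p1 p2) (_ : entl (conv p0 (conv p1 p2)) = entl (conv (conv p0 p2) p1)).
    exact: entl_kvm.
  by rewrite (eq_entl (convA p0 p2 p1)); apply/eq_entl/eq_conv => //; exact: convC.
have tri : e + b <= 2 * s.
  by have := entl_triangle dp1 dp2 dp1; rewrite (entl_convC p2 p1) -/e -/b -/s; lra.
have tri2 : f + a <= 2 * s.
  by have := entl_triangle dp2 dp1 dp2; rewrite (entl_convC p2 p1) -/f -/a -/s; lra.
(* V, W, S and X2 determine all four variables. This bound offsets the difference of [a] and [b]
   left behind by the estimate [tri] of [e]. *)
have J1 : 2 * a + b <= J.
  have := ent_subadd d (fun w => (V w, W w, S w)) X2; rewrite -/J eX2.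
  have h : 2 * a + 2 * b <= ent P (fun w => (V w, W w, S w, X2 w)).
    have -> : 2 * a + 2 * b = ent P (fun w => (X1 w, X1' w, (X2 w, X2' w))).
      rewrite (ent_indep d (ind _ _ (fun a => (a.1, a.2)) (fun a => (a.1, a.2)))).
      rewrite (ent_indep d (i1 _ _ id id)) (ent_indep d (i2 _ _ id id)).
      by rewrite eX1 eX1' eX2 eX2'; ring.
    apply: (le_ent d) => w w' [eqV eqW eqS eq2].
    move: eqV eqW eqS; rewrite /V /W /S eq2 => /addIr -> /addrI -> /addrI /addrI ->.
    by [].
  lra.
have m4 : tau p1 p2 <= J - (e + f) - 21 / 40 * (2 * b + 2 * a - (e + f)) + 1 / 20 * (u + v).
  pose T w := (W2 w, W w).
  have eT : ent P T = e + f.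
    have := ent_indep d (ind _ _ (fun a => a.2 + a.1) (fun a => a.1 + a.2)).
    rewrite -/W2 -/W eW eW2 => <-; apply: (eq_ent d).
      by move=> w w' [e1 e2]; rewrite /T /W2 /W e1 e2.
    by move=> w w' [e1 e2]; move: e1 e2; rewrite /W2 /W => -> ->.
  have i : indep P (fun w => (X2 w, W2 w)) (fun w => (X1' w, W w)).
    move=> x y; have := ind _ _ (fun a => (a.2, a.2 + a.1)) (fun a => (a.1, a.1 + a.2)) y x.
    rewrite mulrC => <-; apply: eq_bigl => w.
    by rewrite !xpair_eqE andbC.
  have ci : cindep P X2 X1' T.
    move=> x y [z1 z2].
    have q1 : pr P (fun w => (X2 w, X1' w, T w)) (x, y, (z1, z2)) =
        pr P (fun w => (X2 w, W2 w, (X1' w, W w))) (x, z1, (y, z2)).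
      by apply: eq_bigl => w; rewrite /T !xpair_eqE -!andbA; do !bool_congr.
    have q2 : pr P (fun w => (X2 w, T w)) (x, (z1, z2)) =
        pr P (fun w => ((X2 w, W2 w), W w)) (x, z1, z2).
      by apply: eq_bigl => w; rewrite /T !xpair_eqE -!andbA.
    have q3 : pr P (fun w => (X1' w, T w)) (y, (z1, z2)) =
        pr P (fun w => (W2 w, (X1' w, W w))) (z1, (y, z2)).
      by apply: eq_bigl => w; rewrite /T !xpair_eqE andbCA.
    rewrite q1 q2 q3 i (indep_comp snd snd i) (indep_comp id snd i) (indep_comp snd id i).
    by rewrite mulrACA [X in _ = X]mulrACA [pr P W _ * _]mulrC.
  have := tau_min_cond X2 X1' T d; rewrite sum_conv_claw // eT.
  rewrite (eq_entl (eq_conv (frefl p0) pX2)) (eq_entl (eq_conv (frefl p0) pX1')) -/u -/v.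
  have -> : ent P (fun w => (X2 w, T w)) = 2 * b + e.
    have := ent_indep d (indep_comp id snd i); rewrite eW.
    have := ent_indep d (i2 _ _ id id); rewrite eX2 eX2'.
    have -> : ent P (fun w => (id (X2 w, W2 w))) = ent P (fun w => (X2 w, X2' w)).
      apply: (eq_ent d) => w w'; rewrite /W2; first by move=> [-> ->].
      by move=> [-> /addrI ->].
    have -> : ent P (fun w => (X2 w, T w)) = ent P (fun w => (id (X2 w, W2 w), W w)).
      by apply: (eq_ent d) => w w'; rewrite /T => -[-> -> ->].
    by move=> /= -> ->; ring.
  have -> : ent P (fun w => (X1' w, T w)) = 2 * a + f.
    have := ent_indep d (indep_comp snd id i); rewrite eW2.
    have := ent_indep d (i1 _ _ id id); rewrite eX1 eX1'.
    have -> : ent P (fun w => (id (X1' w, W w))) = ent P (fun w => (X1 w, X1' w)).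
      apply: (eq_ent d) => w w'; rewrite /W; first by move=> [-> ->].
      by move=> [-> /addrI ->].
    have -> : ent P (fun w => (X1' w, T w)) = ent P (fun w => (W2 w, id (X1' w, W w))).
      by apply: (eq_ent d) => w w'; rewrite /T => -[-> -> ->].
    by move=> /= -> ->; ring.
  have -> : ent P (fun w => (X2 w + X1' w, T w)) = J.
    apply: (eq_ent d) => w w'; rewrite /T /V /W /S /W2.
      move=> [e1 e2 e3]; rewrite (addrC (X2 w)) (addrC (X2 w')) e1 e2; congr (_, (_, _)).
      by move: e3; rewrite (addrC (X1 w)) (addrC (X1 w')) e2 => /addrI.
    move=> [e1 e2 e3]; rewrite (addrC (X1' w) (X2 w)) e1 e3 (addrC (X1' w') (X2 w')).
    by rewrite (addrC (X1 w)) (addrC (X1 w')) e3 e2.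
  lra.
have UVW w : V w + W w = U w.
  rewrite /V /W /U [X1' w + X1 w]addrC addrACA [X2 w + _]addrC addrACA char2 add0r.
  by rewrite addrC.
have VS : ent P (fun w => (V w, S w)) <= 2 * s.
  have : indep P (fun w => X1 w) (fun w => X2' w) by exact: (ind _ _ fst snd).
  move=> /ent_add h.
  have := ent_subadd d V (fun w => X1 w + X2' w); rewrite eV h.
  rewrite (eq_entl (eq_conv pX1 pX2')) -/s.
  suff : ent P (fun w => (V w, S w)) <= ent P (fun w => (V w, X1 w + X2' w)) by lra.
  have SE w : S w = V w + (X1 w + X2' w) by rewrite /S /V (addrC (X1 w)) addrACA.
  by apply: (le_ent d) => w w' [e1 e2]; rewrite !SE e1 e2.
have US : ent P (fun w => (V w + W w, S w)) <= 2 * s.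
  have : indep P (fun w => X1' w) (fun w => X2' w) by exact: (ind _ _ snd snd).
  move=> /ent_add h.
  have := ent_subadd d U (fun w => X1' w + X2' w); rewrite eU h.
  rewrite (eq_entl (eq_conv pX1' pX2')) -/s.
  suff : ent P (fun w => (V w + W w, S w)) <= ent P (fun w => (U w, X1' w + X2' w)) by lra.
  have SE w : S w = U w + (X1' w + X2' w) by rewrite /S /U addrACA.
  by apply: (le_ent d) => w w' [e1 e2]; rewrite !SE !UVW e1 e2.
have WS : ent P (fun w => (W w, S w)) <= e + f.
  have := ent_subadd d W W2; rewrite eW eW2.
  suff : ent P (fun w => (W w, S w)) <= ent P (fun w => (W w, W2 w)) by lra.
  have SE w : S w = W w + W2 w by rewrite /S /W [X1 w + _]addrC.
  by apply: (le_ent d) => w w' [e1 e2]; rewrite !SE e1 e2.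
have m5 := tau_min_cond V W (fun w => (V w + W w, S w)) d.
have m6 := entropic_bsg char2 V W S d.
rewrite (eq_entl (eq_conv (frefl p0) pV)) (eq_entl (eq_conv (frefl p0) pW)) in m5.
rewrite /= -/J -/t in m6.
have VT : ent P (fun w => (V w, (V w + W w, S w))) = J.
  apply: (eq_ent d) => w w'; first by move=> [-> -> ->].
  by move=> [-> /addrI -> ->].
have WT : ent P (fun w => (W w, (V w + W w, S w))) = J.
  apply: (eq_ent d) => w w'; first by move=> [-> -> ->].
  by move=> [-> /addIr -> ->].
rewrite VT WT in m5.
have k : s - (a + b) / 2 <= 17 / 20 * (s - (a + b) / 2) by lra.
by rewrite -/s -/a -/b; lra.
Qed.

End Minimizer.

(** * Existence of a minimiser by compactness *)

Module Minimum.
Import all_classical topology normedtype realfun derive.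
Import numFieldNormedType.Exports.

Section Continuity.
Variable R : realType.

(** With [s] the square root of [x], the bound is [2 s] times [s * (- ln s) <= 1]. It gives
    continuity at 0, where [ln] itself is unbounded. *)
Lemma Nxlnx_le_sqrt (x : R) : x <= 1 -> `|Nxlnx x| <= 2 * Num.sqrt x.
Proof.
move=> x1; have [x0|x0] := leP x 0.
  by rewrite /Nxlnx ln0 // mulr0 oppr0 normr0 mulr_ge0 // sqrtr_ge0.
rewrite /Nxlnx normrN normrM gtr0_norm // ler0_norm ?ln_le0 //.
have s0 : 0 < Num.sqrt x by rewrite sqrtr_gt0.
have sx : x = Num.sqrt x ^+ 2 by rewrite sqr_sqrtr // ltW.
rewrite {1 2}sx lnXn //; set s := Num.sqrt x in s0 *.
have := @ln_le_sub1 R s^-1; rewrite invr_gt0 s0 lnV ?posrE // => /(_ isT) h.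
have h2 : s * (- ln s) <= 1.
  have : s * (- ln s) <= s * (s^-1 - 1) by rewrite ler_pM2l.
  by rewrite mulrBr divff ?gt_eqF //; lra.
have -> : s ^+ 2 * - (ln s *+ 2) = 2 * s * (s * - ln s) by ring.
rewrite -[leRHS]mulr1 ler_pM2l // mulr_gt0 //.
Qed.

(** The default value [ln x = 0] for [x <= 0] makes the function vanish on the negative axis, so
    continuity holds on the whole line and no restriction to an interval is carried along. *)
Lemma continuous_Nxlnx : continuous (@Nxlnx R).
Proof.
move=> x; have [x0|x0|->] := ltgtP x 0.
- have hn : {near (x : R), cst 0 =1 @Nxlnx R}.
    have h := lt_le_nbhsl x0; near=> y; rewrite /Nxlnx ln0 ?mulr0 ?oppr0 //.
    by near: y.
  apply: cvg_trans (near_eq_cvg hn) _.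
  by rewrite /Nxlnx ln0 ?ltW // mulr0 oppr0; exact: cvg_cst.
- have h : (y * ln y @[y --> x] --> x * ln x)%classic.
    by apply: cvgM; [exact: cvg_id|exact: continuous_ln].
  exact: (cvgN h).
- have h : (2 * Num.sqrt y @[y --> (0 : R)] --> (0 : R))%classic.
    have e : 2 * Num.sqrt (0 : R) = 0 by rewrite sqrtr0 mulr0.
    by rewrite -[X in (_ --> X)%classic]e; apply: cvgM; [exact: cvg_cst|exact: sqrt_continuous].
  have hN : (- (2 * Num.sqrt y) @[y --> (0 : R)] --> (0 : R))%classic.
    by rewrite -[X in (_ --> X)%classic]oppr0; apply: cvgN; exact: h.
  have hn : \forall y \near (0 : R), - (2 * Num.sqrt y) <= Nxlnx y <= 2 * Num.sqrt y.
    have h1 := lt_le_nbhsl (@ltr01 R); near=> y; rewrite -ler_norml; apply: Nxlnx_le_sqrt.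
    by near: y.
  by rewrite /continuous_at Nxlnx0; exact: (squeeze_cvgr hn hN h).
Unshelve. all: by end_near. Qed.

Lemma continuous_sumr (T : topologicalType) (I : Type) (r : seq I) (F : I -> T -> R) :
  (forall i, continuous (F i)) -> continuous (fun x => \sum_(i <- r) F i x).
Proof.
move=> h; elim: r => [|i r IH] x.
  by under eq_fun do rewrite big_nil; exact: cvg_cst.
by under eq_fun do rewrite big_cons; apply: cvgD; [exact: h|exact: IH].
Qed.

End Continuity.

Section MinimizerExists.
Variables (R : realType) (G : finZmodType) (p0 : G -> R).
Local Open Scope classical_set_scope.

Lemma continuous_entl (T : topologicalType) (F : T -> G -> R) :
  (forall x, continuous (fun v => F v x)) -> continuous (fun v => entl (F v)).
Proof.
move=> h; apply: continuous_sumr => x v.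
exact: (continuous_comp (h x v) (@continuous_Nxlnx R _)).
Qed.

Lemma continuous_conv (T : topologicalType) (F F' : T -> G -> R) x :
  (forall x, continuous (fun v => F v x)) -> (forall x, continuous (fun v => F' v x)) ->
  continuous (fun v => conv (F v) (F' v) x).
Proof.
by move=> h h'; apply: continuous_sumr => y v; apply: cvgM; [exact: h|exact: h'].
Qed.

(** A pair of laws is coded as one row vector indexed by [bool * G]. The pairs then form a closed
    subset of a cube, on which the continuous [tau] attains its minimum. *)
Lemma tau_min_exists : dist p0 -> exists p1 p2, [/\ dist p1, dist p2 &
  forall q1 q2, dist q1 -> dist q2 -> tau p0 p1 p2 <= tau p0 q1 q2].
Proof.
move=> dp0.
pose n := #|{: bool * G}|.
pose d (b : bool) (v : 'rV[R]_n) x : R := v ord0 (enum_rank (b, x)).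
pose code (q1 q2 : G -> R) : 'rV[R]_n :=
  \row_i (if (enum_val i).1 then q1 else q2) (enum_val i).2.
have codeE b q1 q2 : d b (code q1 q2) =1 if b then q1 else q2.
  by move=> x; rewrite /d mxE enum_rankK.
have cd b x : continuous (fun v => d b v x) by move=> v; exact: coord_continuous.
pose A := [set v : 'rV[R]_n | forall i, `[0, 1] (v ord0 i)] `&`
   ([set v | \sum_x d true v x = 1] `&` [set v | \sum_x d false v x = 1]).
have cA : compact A.
  apply: compact_closedI.
    by apply: (@rV_compact R n (fun=> `[0, 1])) => _; exact: segment_compact.
  have cl b : closed [set v : 'rV[R]_n | \sum_x d b v x = 1].
    apply: (@closed_comp _ _ (fun v => \sum_x d b v x) [set x | x = 1]).
      by move=> v _; apply: continuous_sumr => x; exact: cd.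
    exact: closed_eq.
  by apply: closedI; exact: cl.
have dA v b : A v -> dist (d b v).
  move=> [h1 [h2 h3]]; split; last by case: b.
  by move=> x; have := h1 (enum_rank (b, x)); rewrite /= in_itv /= => /andP[].
have codeA q1 q2 : dist q1 -> dist q2 -> A (code q1 q2).
  move=> d1 d2; split=> [i|].
    have h q : dist q -> forall x : G, `[0, 1] (q x).
      move=> dq x; rewrite /= in_itv /= dq.1 /= -dq.2 (bigD1 x) //= lerDl.
      by apply: sumr_ge0 => y _; exact: dq.1.
    by rewrite mxE; case: ifP => _; apply: h.
  by split; rewrite /= (eq_bigr _ (fun x _ => codeE _ _ _ x)) ?d1.2 ?d2.2.
have tauE q1 q2 : tau p0 (d true (code q1 q2)) (d false (code q1 q2)) = tau p0 q1 q2.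
  rewrite /tau (eq_entl (codeE true q1 q2)) (eq_entl (codeE false q1 q2)).
  rewrite (eq_entl (eq_conv (codeE true q1 q2) (codeE false q1 q2))).
  rewrite (eq_entl (eq_conv (frefl p0) (codeE true q1 q2))).
  by rewrite (eq_entl (eq_conv (frefl p0) (codeE false q1 q2))).
have A0 : A !=set0 by exists (code p0 p0); apply: codeA.
have ct : {within A, continuous (fun v => tau p0 (d true v) (d false v))}.
  apply: continuous_subspaceT => v.
  have c0 : forall x, continuous (fun _ : 'rV[R]_n => p0 x) by move=> x; exact: cst_continuous.
  have h1 := @continuous_entl _ (fun v => conv (d true v) (d false v))
    (fun x => continuous_conv (cd true) (cd false)) v.
  have h2 b := @continuous_entl _ (d b) (cd b) v.
  have h3 b := @continuous_entl _ (fun v => conv p0 (d b v))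
    (fun x => continuous_conv c0 (cd b)) v.
  have c1 (k : R) := @cst_continuous _ R k v.
  exact: (cvgD (cvgB h1 (cvgM (c1 (21 / 40)) (cvgD (h2 true) (h2 false))))
    (cvgM (c1 (1 / 20)) (cvgD (h3 true) (h3 false)))).
have [v vA vmin] := compact_EVT_min A0 cA ct.
exists (d true v), (d false v); rewrite inE in vA; split; [exact: dA|exact: dA|].
move=> q1 q2 d1 d2; rewrite -(tauE q1 q2); apply: vmin; rewrite inE; exact: codeA.
Qed.

End MinimizerExists.

End Minimum.

Section Average.
Variable R : realType.

Lemma dist_exists_le (T : finType) (p t : T -> R) (c : R) :
  dist p -> \sum_x p x * t x <= c -> exists2 x, 0 < p x & t x <= c.
Proof.
move=> dp h; have [/existsP[x /andP[? ?]]|/existsPn no] := boolP [exists x, (0 < p x) && (t x <= c)].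
  by exists x.
have h0 x : 0 <= p x * (t x - c).
  have := no x; rewrite negb_and -leNgt -ltNge => /orP[px|tc].
    by rewrite (_ : p x = 0) ?mul0r //; apply/eqP; rewrite eq_le px dp.1.
  by rewrite mulr_ge0 ?dp.1 // subr_ge0 ltW.
have s0 : \sum_x p x * (t x - c) = 0.
  apply/eqP; rewrite eq_le sumr_ge0 // andbT.
  under eq_bigr do rewrite mulrBr.
  by rewrite sumrB -mulr_suml dp.2 mul1r subr_le0.
have z : \sum_x p x = 0; last by have := dp.2; rewrite z => /eqP; rewrite eq_sym oner_eq0.
apply: big1 => x _; have /eqP := @psumr_eq0P R _ _ _ (fun x _ => h0 x) s0 x isT.
rewrite mulf_eq0 => /orP[/eqP //|]; rewrite subr_eq0 => /eqP tc.
have := no x; rewrite tc lexx andbT -leNgt => px.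
by apply/eqP; rewrite eq_le px dp.1.
Qed.

Lemma sum_indicator (T : finType) (A : {set T}) : \sum_x (x \in A)%:R = #|A|%:R :> R.
Proof.
rewrite -sum1_card natr_sum [RHS]big_mkcond /=; apply: eq_bigr => x _.
by case: (x \in A).
Qed.

Lemma dist_exists_gt0 (T : finType) (p : T -> R) : dist p -> exists x, 0 < p x.
Proof.
move=> dp; have [|x px _] := @dist_exists_le T p (fun=> 0) 0 dp; last by exists x.
by rewrite big1 // => x _; rewrite mulr0.
Qed.

End Average.

Section Uniform.
Variables (R : realType) (T : finType).

Definition unif (A : {set T}) (x : T) : R := (x \in A)%:R / #|A|%:R.

Lemma dist_unif (A : {set T}) : (0 < #|A|)%N -> dist (unif A).
Proof.
move=> A0; split=> [x|]; first by rewrite divr_ge0.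
by rewrite -mulr_suml sum_indicator divff // pnatr_eq0 -lt0n.
Qed.

Lemma entl_unif (A : {set T}) : (0 < #|A|)%N -> entl (unif A) = ln #|A|%:R.
Proof.
move=> A0; have A0' : 0 < #|A|%:R :> R by rewrite ltr0n.
rewrite /entl (bigID (mem A)) /= [X in _ + X]big1 ?addr0 => [|x /negbTE xA]; last first.
  by rewrite /unif xA mul0r Nxlnx0.
rewrite (eq_bigr (fun=> ln #|A|%:R / #|A|%:R)) => [|x xA].
  by rewrite sumr_const -[LHS]mulr_natr divfK // gt_eqF.
by rewrite /unif xA mul1r /Nxlnx lnV ?posrE // mulrN opprK mulrC.
Qed.

End Uniform.
Arguments unif {R T} A x.
Arguments dist_unif {R T A}.
Arguments entl_unif {R T A}.

(** * From zero Ruzsa distance to a subgroup *)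

Section PFR.
Variables (R : realType) (G : finZmodType).

(* Equality case of H(X + Y) >= H(X): every translate of the law of X by a point of
   the support of Y is the law of X + Y. *)
Lemma entl_conv_eq (p q : G -> R) : dist p -> dist q -> entl (conv p q) <= entl p ->
  forall y, 0 < q y -> forall x, p (x - y) = conv p q x.
Proof.
move=> dp dq hle.
pose m := conv q p.
have m0 x : 0 <= m x by apply: sumr_ge0 => y _; rewrite mulr_ge0 ?dp.1 ?dq.1.
(* Summed over [x], this is the relative entropy of the translate of [p] by [y] with respect to [m].
   Its average over [q] is H(X + Y) - H(X) <= 0, so every non-negative summand vanishes. *)
pose g y x := p (x - y) * ln (p (x - y)) - p (x - y) * ln (m x) - p (x - y) + m x.
have mz x y : 0 < q y -> m x = 0 -> p (x - y) = 0.
  move=> qy mx; have := @psumr_eq0P R _ _ _ (fun y _ => mulr_ge0 (dq.1 y) (dp.1 (x - y))) mx y isT.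
  by move/eqP; rewrite mulf_eq0 gt_eqF //= => /eqP.
have g0 y x : 0 <= q y * g y x.
  have [->|qy] := eqVneq (q y) 0; first by rewrite mul0r.
  have qy0 : 0 < q y by rewrite lt_neqAle eq_sym qy dq.1.
  by rewrite mulr_ge0 ?dq.1 // gibbs_pt ?dp.1 //; exact: mz.
have sp y : \sum_x p (x - y) = 1.
  by rewrite -dp.2 (reindex_inj (addIr y)) /=; apply: eq_bigr => x _; rewrite addrK.
have sH y : \sum_x p (x - y) * ln (p (x - y)) = - entl p.
  rewrite (reindex_inj (addIr y)) /= /entl -sumrN; apply: eq_bigr => x _.
  by rewrite addrK /Nxlnx opprK.
have dm : dist m by exact: dist_conv.
have tot : \sum_y \sum_x q y * g y x = 0.
  apply/eqP; rewrite eq_le sumr_ge0 ?andbT => [|y _]; last exact: sumr_ge0.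
  have -> : \sum_y \sum_x q y * g y x = entl m - entl p.
    transitivity (\sum_y (q y * (- entl p) - \sum_x q y * p (x - y) * ln (m x))).
      apply: eq_bigr => y _.
      rewrite -mulr_sumr /g big_split /= big_split /= sumrN sumrB sH sp dm.2.
      rewrite addrNK mulrBr; congr (_ - _).
      by rewrite mulr_sumr; apply: eq_bigr => x _; rewrite mulrA.
    rewrite sumrB -mulr_suml dq.2 mul1r addrC; congr (_ + _).
    rewrite exchange_big /= /entl -sumrN; apply: eq_bigr => x _.
    by rewrite -mulr_suml.
  by rewrite /m entl_convC; lra.
move=> y qy x.
have sg0 y' : 0 <= \sum_x q y' * g y' x by exact: sumr_ge0.
have h1 := @psumr_eq0P R _ _ _ (fun y _ => sg0 y) tot y isT.
have /eqP h2 := @psumr_eq0P R _ _ _ (fun x _ => g0 y x) h1 x isT.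
move: h2; rewrite mulf_eq0 gt_eqF //= => /eqP h2.
rewrite (convC p q) -/(m x).
by apply: gibbs_pt_eq h2; [exact: dp.1|exact: m0|exact: mz].
Qed.

Hypothesis char2 : forall x : G, x + x = 0.

(** At a minimiser the equality case [entl_conv_eq] applies in both directions, so each of the two
    laws is invariant under differences from the support of the other. Hence [p1] is uniform on a
    coset of its stabiliser, which is the subgroup sought. *)
Theorem pfr (A : {set G}) (D : R) : (0 < #|A|)%N ->
  entl (conv (unif A) (unif A)) <= ln #|A|%:R + D ->
  exists (H : {set G}) (c : G), [/\ 0 \in H, {in H &, forall x y, x + y \in H},
    #|H|%:R <= expR (44 * D) * #|A|%:R &
    expR (- (44 * D)) * #|A|%:R <= #|[set x in A | x - c \in H]|%:R].
Proof.
move=> A0 dbl; have dp0 : dist (unif A : G -> R) := dist_unif A0.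
have A0' : 0 < #|A|%:R :> R by rewrite ltr0n.
have [p1 [p2 [d1 d2 tmin]]] := Minimum.tau_min_exists dp0.
have k0 := tau_min_doubling char2 dp0 d1 d2 tmin.
have ge1 : entl p1 <= entl (conv p1 p2) by rewrite entl_convC; exact: entl_conv_ge.
have ge2 : entl p2 <= entl (conv p1 p2) by exact: entl_conv_ge.
have inv1 : forall y y', 0 < p2 y -> 0 < p2 y' -> forall x, p1 (x + (y' - y)) = p1 x.
  move=> y y' hy hy' x.
  have e1 := entl_conv_eq d1 d2 (_ : entl (conv p1 p2) <= entl p1).
  have /e1 e : entl (conv p1 p2) <= entl p1 by lra.
  by rewrite addrA (e _ hy) -(e _ hy') addrK.
have inv2 : forall y y', 0 < p1 y -> 0 < p1 y' -> forall x, p2 (x + (y' - y)) = p2 x.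
  move=> y y' hy hy' x.
  have e1 := entl_conv_eq d2 d1 (_ : entl (conv p2 p1) <= entl p2).
  have /e1 e : entl (conv p2 p1) <= entl p2 by rewrite entl_convC; lra.
  by rewrite addrA (e _ hy) -(e _ hy') addrK.
have [x0 px0] := dist_exists_gt0 d1; have [y0 py0] := dist_exists_gt0 d2.
pose H := [set h | [forall x, p1 (x + h) == p1 x]].
have HP h : reflect (forall x, p1 (x + h) = p1 x) (h \in H).
  rewrite inE; apply: (iffP forallP) => hh x; first exact/eqP.
  by rewrite hh.
have H0 : 0 \in H by apply/HP => x; rewrite addr0.
have HD : {in H &, forall x y, x + y \in H}.
  by move=> h h' /HP hh /HP hh'; apply/HP => x; rewrite addrA hh' hh.
have HN x : (- x \in H) = (x \in H).
  have opp_char2 : - x = x by apply/esym/eqP; rewrite -subr_eq0 opprK char2.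
  by rewrite opp_char2.
have supp x : (0 < p1 x) = (x - x0 \in H).
  apply/idP/idP => [px|/HP/(_ x0)]; last by rewrite addrC subrK => ->.
  (* The shift [x - x0] preserves [p2], hence moves [y0] to another point of its support; a
     difference inside that support preserves [p1]. *)
  apply/HP => z; have := inv2 _ _ px0 px y0; set h := x - x0 => e.
  have := inv1 _ _ py0 (_ : 0 < p2 (y0 + h)) z; rewrite e => /(_ py0).
  by rewrite addrAC subrr add0r.
pose C := [set x | x - x0 \in H].
have cardC : #|C| = #|H|.
  rewrite -(card_imset _ (addIr (- x0))); apply: eq_card => x.
  apply/imsetP/idP => [[y + ->]|xH]; first by rewrite inE.
  by exists (x + x0); rewrite ?addrK // in_set addrK.
have p1c x : x \in C -> p1 x = p1 x0.
  by rewrite inE => /HP/(_ x0); rewrite addrC subrK.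
have p1n x : x \notin C -> p1 x = 0.
  by rewrite inE -supp -leNgt => h; apply/eqP; rewrite eq_le h d1.1.
have Hpos : (0 < #|H|)%N by apply/card_gt0P; exists 0.
have Hpos' : 0 < #|H|%:R :> R by rewrite ltr0n.
have p1x0 : p1 x0 = #|H|%:R^-1.
  have := d1.2; rewrite (bigID (mem C)) /= [X in _ + X]big1 ?addr0 => [|x /p1n //].
  rewrite (eq_bigr (fun=> p1 x0)) => [|x /p1c //].
  by rewrite sumr_const cardC -[p1 x0 *+ _]mulr_natr => /(canRL (mulfK (lt0r_neq0 Hpos'))); rewrite mul1r.
have p1E : p1 =1 unif C.
  move=> x; rewrite /unif cardC; case: (boolP (x \in C)) => xC.
    by rewrite p1c // p1x0 mul1r.
  by rewrite p1n // mul0r.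
have hH : entl p1 = ln #|H|%:R by rewrite (eq_entl p1E) entl_unif cardC.
pose u := entl (conv (unif A) p1); pose v := entl (conv (unif A) p2).
have t0 := tmin _ _ dp0 dp0.
have v1 : ln #|A|%:R <= v by rewrite -entl_unif // /v entl_convC; exact: entl_conv_ge.
have v2 : entl p2 <= v by exact: entl_conv_ge.
have u1 : ln #|A|%:R <= u by rewrite -entl_unif // /u entl_convC; exact: entl_conv_ge.
have u2 : entl p1 <= u by exact: entl_conv_ge.
rewrite /tau -/u -/v entl_unif // in t0.
(* Comparing the minimum with the value of [tau] at the pair of uniform laws on [A], and multiplying
   by 20, bounds the sum of the distances from [unif A] to [p1] and to [p2] by [20 * (11 / 10) * D];
   the second distance is non-negative. With [u1] and [u2], the logarithms of [#|H|] and [#|A|] then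
   differ by at most [44 * D]. *)
have key : u - ln #|H|%:R / 2 - ln #|A|%:R / 2 <= 22 * D by lra.
(* Some point has mass at least [expR (- u)] under the law of the sum. That mass is the size of the
   intersection of [A] with a coset of [H], divided by [#|A| * #|H|]. *)
have hu : \sum_x conv (unif A) p1 x * (- ln (conv (unif A) p1 x)) <= u.
  by apply: ler_sum => x _; rewrite /Nxlnx mulrN.
have [x rx xle] := dist_exists_le (dist_conv dp0 d1) hu.
exists H, (x - x0); split=> //.
  rewrite -ler_ln ?posrE ?mulr_gt0 ?expR_gt0 // lnM ?posrE ?expR_gt0 // expRK; lra.
set B := [set y in A | _].
have cE : conv (unif A) p1 x = #|B|%:R / (#|A|%:R * #|H|%:R).
  rewrite /conv (eq_bigr (fun y => (y \in B)%:R / (#|A|%:R * #|H|%:R))) => [|y _].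
    by rewrite -mulr_suml sum_indicator.
  have e : (x - y \in C) = (y - (x - x0) \in H).
    by rewrite in_set -HN !opprB addrCA.
  have eB : (y \in B) = (y \in A) && (y - (x - x0) \in H) by rewrite /B in_set.
  rewrite p1E /unif cardC e eB.
  case: (y \in A); first by rewrite mul1r mulrCA invfM.
  by rewrite andFb !mul0r.
have B0 : 0 < #|B|%:R :> R.
  have := rx; rewrite cE pmulr_lgt0 // invr_gt0 mulr_gt0 //.
rewrite -ler_ln ?posrE ?mulr_gt0 ?expR_gt0 // lnM ?posrE ?expR_gt0 // expRK.
move: xle; rewrite cE ln_div ?posrE ?mulr_gt0 // lnM ?posrE //; lra.
Qed.

End PFR.

(** * Structure of self-dual weights *)

Section BSG.
Variables (R : realType) (G : finZmodType).
Hypothesis char2 : forall x : G, x + x = 0.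

(** The entropic inequality is applied to a uniform random pair from [D], with trivial [S]. Given
    the sum [z], either coordinate is uniform on the set [B] of [z]. The bound holds on average over
    [z]: [4 ln #|A| - 2 ln #|D| + H(Z)] from the inequality, less the conditional entropy
    [ln #|D| - H(Z)]. *)
Lemma balog_szemeredi_gowers (A P : {set G}) :
  let D := [set w : G * G | [&& w.1 \in A, w.2 \in A & w.1 + w.2 \in P]] in
  (0 < #|D|)%N ->
  exists z, let B := [set a in A | z - a \in A] in
  [/\ z \in P, (0 < #|B|)%N &
     entl (conv (unif B) (unif B)) <= ln #|B|%:R +
      (4 * ln #|A|%:R - 3 * ln #|D|%:R + 2 * ln #|P|%:R :> R)].
Proof.
move=> D D0.
pose B z := [set a in A | z - a \in A].
pose p : G * G -> R := unif D; have dp : dist p by exact: dist_unif.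
have D0' : 0 < #|D|%:R :> R by rewrite ltr0n.
pose Z (w : G * G) := (w.1 + w.2, tt).
have pD w : 0 < p w -> w \in D.
  by rewrite /p /unif; case: (w \in D) => //; rewrite mul0r ltxx.
have inB z a : z \in P -> ((a, z - a) \in D) = (a \in B z).
  by move=> zP; rewrite !inE /= [a + _]addrC subrK zP andbT.
have prA a z : pr p (fun w => (w.1, Z w)) (a, (z, tt)) = p (a, z - a).
  rewrite /pr (big_pred1 (a, z - a)) // => -[b c]; rewrite /= /Z !xpair_eqE /= ?eqxx ?andbT.
  by case: (b =P a) => //= ->; rewrite addrC -[LHS](inj_eq (addIr (- a))) addrK.
have prB a z : pr p (fun w => (w.2, Z w)) (a, (z, tt)) = p (z - a, a).
  rewrite /pr (big_pred1 (z - a, a)) // => -[b c]; rewrite /= /Z !xpair_eqE /= ?eqxx ?andbT.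
  by rewrite [RHS]andbC; case: (c =P a) => //= ->; rewrite -[LHS](inj_eq (addIr (- a))) addrK.
have psym a z : p (z - a, a) = p (a, z - a).
  by rewrite /p /unif !inE /= (addrC a) !subrK andbCA.
have zP z : 0 < pr p Z (z, tt) -> z \in P.
  have [/exists_inP[[a b] abD] /eqP[<-] _|/exists_inPn no] := boolP [exists w in D, Z w == (z, tt)].
    by move: abD; rewrite inE => /and3P[].
  rewrite /pr big1 ?ltxx // => w wz; apply/eqP; rewrite eq_le dp.1 andbT leNgt.
  by apply/negP => /pD/no; rewrite wz.
have pB z a : z \in P -> p (a, z - a) = (a \in B z)%:R / #|D|%:R.
  by move=> zinP; rewrite /p /unif inB.
have prZ z : z \in P -> pr p Z (z, tt) = #|B z|%:R / #|D|%:R.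
  move=> zinP; rewrite -(pr_pair_sum p (fun w => w.1)) -sum_indicator mulr_suml.
  by apply: eq_bigr => a _; rewrite prA pB.
have clA z : 0 < pr p Z (z, tt) -> claw p (fun w => w.1) Z (z, tt) =1 unif (B z).
  move=> h a; have zinP := zP _ h; rewrite /claw prA pB // prZ // /unif invf_div.
  by rewrite mulrA mulrVK // unitfE gt_eqF.
have clB z : 0 < pr p Z (z, tt) -> claw p (fun w => w.2) Z (z, tt) =1 unif (B z).
  move=> h a; have zinP := zP _ h; rewrite /claw prB psym pB // prZ // /unif invf_div.
  by rewrite mulrA mulrVK // unitfE gt_eqF.
have main := entropic_bsg char2 (fun w => w.1) (fun w => w.2) (fun=> tt) dp.
have cond := sum_Nxlnx_claw dp (fun w => w.1) Z.
have eD : ent p id = ln #|D|%:R by rewrite ent_id; exact: entl_unif.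
have eAB : ent p (fun w => (w.1, w.2, tt)) = ln #|D|%:R.
  by rewrite -eD; apply: (eq_ent dp) => -[a b] [a' b'] /= [-> ->].
have eAZ : ent p (fun w => (w.1, Z w)) = ln #|D|%:R.
  by rewrite -eD; apply: (eq_ent dp) => -[a b] [a' b'] /= [->]; [move=> ->|move/addrI ->].
have eA : ent p (fun w => (w.1, tt)) <= ln #|A|%:R.
  apply: le_trans (@ent_le_card _ _ _ dp _ (fun w => w.1) A _).
    by apply: (le_ent dp) => w w' /= ->.
  by move=> w /pD; rewrite inE => /andP[].
have eB : ent p (fun w => (w.2, tt)) <= ln #|A|%:R.
  apply: le_trans (@ent_le_card _ _ _ dp _ (fun w => w.2) A _).
    by apply: (le_ent dp) => w w' /= ->.
  by move=> w /pD; rewrite inE => /and3P[].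
have eZ : ent p Z <= ln #|P|%:R.
  apply: le_trans (@ent_le_card _ _ _ dp _ (fun w => w.1 + w.2) P _).
    by apply: (le_ent dp) => w w' /=; rewrite /Z => ->.
  by move=> w /pD; rewrite inE => /and3P[].
have e1 : ent p (fun=> tt) = 0 by exact: ent_unit.
rewrite /= -/Z eAB e1 in main; rewrite eAZ in cond.
have avg : \sum_z pr p Z z * (entl (conv (claw p (fun w => w.1) Z z) (claw p (fun w => w.2) Z z))
    - entl (claw p (fun w => w.1) Z z)) <= 4 * ln #|A|%:R - 3 * ln #|D|%:R + 2 * ln #|P|%:R.
  under eq_bigr do rewrite mulrBr.
  rewrite sumrB /entl cond; rewrite /entl in main; lra.
have [[z []] hz le] := dist_exists_le (dist_pr dp Z) avg.
have zinP := zP _ hz.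
have B0 : (0 < #|B z|)%N.
  by move: hz; rewrite prZ // pmulr_lgt0 ?invr_gt0 // ltr0n.
exists z; split => //.
rewrite -/(B z) -lerBlDl -entl_unif //.
by rewrite -(eq_entl (clA z hz)) -(eq_entl (eq_conv (clA z hz) (clB z hz))).
Qed.

End BSG.

Section SelfDual.
Variables (R : realType) (G : finZmodType) (N : R) (B : G -> G -> R) (Q : G -> R).
Hypothesis char2 : forall x : G, x + x = 0.
Hypothesis N0 : 0 < N.
Hypothesis BD : forall w g g', B w (g + g') = B w g * B w g'.
Hypothesis Bpm : forall w g, B w g = 1 \/ B w g = -1.
Hypothesis Bsym : forall w g, B w g = B g w.
Hypothesis Q0 : forall g, 0 <= Q g.
Hypothesis Qdual : forall g, Q g = N^-1 * \sum_w Q w * B w g.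

(** By duality the left side is a combination, with the non-negative weights [Q w], of [B w c] times
    a character sum over [K]. That sum is 0 or [#|K|], so replacing [B w c] by 1 can only increase
    the total. *)
Lemma coset_le (K : {set G}) (c : G) : 0 \in K -> {in K &, forall x y, x + y \in K} ->
  \sum_(g in K) Q (g + c) <= \sum_(g in K) Q g.
Proof.
move=> K0 KD.
have E x : \sum_(g in K) Q (g + x) = N^-1 * \sum_w Q w * (B w x * \sum_(g in K) B w g).
  under eq_bigr do rewrite Qdual.
  rewrite -mulr_sumr exchange_big /=; congr (_ * _); apply: eq_bigr => w _.
  by rewrite -mulr_sumr; congr (_ * _); rewrite mulr_sumr; apply: eq_bigr => g _; rewrite BD mulrC.
have -> : \sum_(g in K) Q g = \sum_(g in K) Q (g + 0) by apply: eq_bigr => g _; rewrite addr0.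
rewrite !E ler_pM2l ?invr_gt0 //; apply: ler_sum => w _.
apply: ler_wpM2l => //.
have -> : B w 0 = 1.
  by case: (Bpm w 0) => // h; have := BD w 0 0; rewrite addr0 h; lra.
have [/exists_inP[g0 g0K /eqP h]|/exists_inPn no] := boolP [exists g in K, B w g == -1].
  suff -> : \sum_(g in K) B w g = 0 by rewrite !mulr0.
  have e : \sum_(g in K) B w g = - \sum_(g in K) B w g.
    rewrite {1}(reindex_inj (addIr g0)) /= -sumrN.
    rewrite (eq_bigl (mem K)) => [|g]; last first.
      apply/idP/idP => [gK|gK]; last exact: KD.
      by rewrite -[g]addr0 -(char2 g0) addrA; apply: KD.
    by apply: eq_bigr => g _; rewrite BD h mulrN1.
  lra.
have -> : \sum_(g in K) B w g = \sum_(g in K) 1.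
  by apply: eq_bigr => g gK; case: (Bpm w g) => // h; have := no _ gK; rewrite h eqxx.
apply: ler_wpM2r; first exact: sumr_ge0.
by case: (Bpm w c) => ->; lra.
Qed.

(** Once [Q (a + b + c)] is expanded by duality, the three sums factor, each giving [N * Q w]. *)
Lemma energyE : \sum_a \sum_b \sum_c Q a * Q b * Q c * Q (a + b + c) =
  N ^+ 2 * \sum_w Q w ^+ 4.
Proof.
have S w : \sum_a Q a * B w a = N * Q w.
  by rewrite Qdual mulVKf ?gt_eqF //; apply: eq_bigr => a _; rewrite Bsym.
transitivity (N^-1 * \sum_w Q w * (\sum_a Q a * B w a) ^+ 3); last first.
  rewrite !mulr_sumr; apply: eq_bigr => w _; rewrite S; field; exact: lt0r_neq0.
under eq_bigr do under eq_bigr do under eq_bigr do rewrite [Q (_ + _)]Qdual mulrCA mulr_sumr.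
under eq_bigr do under eq_bigr do rewrite -mulr_sumr exchange_big /=.
under eq_bigr do rewrite -mulr_sumr exchange_big /=.
rewrite -mulr_sumr exchange_big /=; congr (_ * _); apply: eq_bigr => w _.
rewrite !exprS expr0 mulr1 mulr_suml mulr_sumr; apply: eq_bigr => a _.
rewrite mulr_suml !mulr_sumr; apply: eq_bigr => b _.
rewrite !mulr_sumr; apply: eq_bigr => c _.
by rewrite !BD; ring.
Qed.

Hypothesis Qle1 : forall g, Q g <= 1.
Hypothesis Qsum : \sum_g Q g <= N.
Variable e : R.
Hypothesis e0 : 0 < e.
Hypothesis Qsq : e * N <= \sum_g Q g ^+ 2.

Lemma density_le1 : e <= 1.
Proof.
rewrite -(ler_pM2r N0) mul1r; apply: le_trans Qsq _; apply: le_trans Qsum.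
by apply: ler_sum => g _; rewrite expr2 -[leRHS]mulr1 ler_wpM2l.
Qed.

(** A termwise substitute for Holder's inequality: [Q^4] dominates
    [(e / 2)^2 * (Q^2 - (e / 2) * Q)], whose bracket is non-positive where [Q] is below [e / 2]. *)
Lemma sum_pow4 : e ^+ 3 / 8 * N <= \sum_g Q g ^+ 4.
Proof.
have he := e0.
apply: (@le_trans _ _ (\sum_g (e / 2) ^+ 2 * (Q g ^+ 2 - e / 2 * Q g))).
  rewrite -mulr_sumr sumrB -mulr_sumr.
  apply: (@le_trans _ _ ((e / 2) ^+ 2 * (e * N - e / 2 * N))).
    by rewrite le_eqVlt; apply/orP; left; apply/eqP; field.
  apply: ler_wpM2l; first exact: sqr_ge0.
  by apply: lerB => //; apply: ler_wpM2l => //; lra.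
apply: ler_sum => g _; have [h|h] := leP (e / 2) (Q g).
  rewrite (_ : Q g ^+ 4 = Q g ^+ 2 * Q g ^+ 2); last by ring.
  apply: (@le_trans _ _ ((e / 2) ^+ 2 * Q g ^+ 2)).
    apply: ler_wpM2l; first exact: sqr_ge0.
    by rewrite lerBlDr lerDl mulr_ge0 //; lra.
  apply: ler_wpM2r; first exact: sqr_ge0.
  by rewrite ler_sqr ?nnegrE //; lra.
apply: (@le_trans _ _ 0); last by rewrite exprn_ge0.
apply: mulr_ge0_le0; first exact: sqr_ge0.
by rewrite expr2 -mulrBl; apply: mulr_le0_ge0 => //; lra.
Qed.

(** Discarding values below the level costs at most [4 * level * N^3], which is half of the energy
    [e^3 / 8 * N^3]. *)
Definition level := e ^+ 3 / 64.
Definition level_set := [set g | level <= Q g].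

Lemma level_gt0 : 0 < level. Proof. by rewrite divr_gt0 // exprn_gt0. Qed.

Lemma card_level_set : #|level_set|%:R * level <= N.
Proof.
apply: le_trans Qsum; rewrite [leRHS](bigID (mem level_set)) /=.
apply: (@le_trans _ _ (\sum_(g in level_set) Q g)); last by rewrite lerDl sumr_ge0.
rewrite -sum1_card natr_sum mulr_suml; apply: ler_sum => g; rewrite inE mul1r; exact.
Qed.

Definition reps z := #|[set a in level_set | z - a \in level_set]|.

Lemma opp_char2 (x : G) : - x = x.
Proof. by apply/esym/eqP; rewrite -subr_eq0 opprK char2. Qed.

Lemma energy_level_set : e ^+ 3 / 16 * N ^+ 3 <= \sum_(a in level_set) \sum_(b in level_set) (reps (a + b))%:R.
Proof.
have he := e0.
pose I g : R := (g \in level_set)%:R.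
have EA : \sum_(a in level_set) \sum_(b in level_set) (reps (a + b))%:R =
    \sum_a \sum_b \sum_c I a * I b * I c * I (a + b + c).
  rewrite big_mkcond /=; apply: eq_bigr => a _; rewrite /I.
  case: (a \in level_set); last by rewrite big1 // => b _; rewrite big1 // => c _; rewrite !mul0r.
  rewrite big_mkcond /=; apply: eq_bigr => b _.
  case: (b \in level_set); last by rewrite big1 // => c _; rewrite mulr0 !mul0r.
  rewrite /reps -sum_indicator; apply: eq_bigr => c _; rewrite in_set opp_char2.
  by rewrite !mul1r -natrM mulnb.
(* Either all four points are in the level set and the product is at most 1, or one factor is below
   the level and the other three remain. *)
have pt a b c d : Q a * Q b * Q c * Q d <= I a * I b * I c * I d +
    level * (Q b * Q c * Q d + Q a * Q c * Q d + Q a * Q b * Q d + Q a * Q b * Q c).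
  have dl0 := level_gt0.
  have QQ x y z : 0 <= Q x * Q y * Q z by rewrite !mulr_ge0.
  have II : 0 <= I a * I b * I c * I d by rewrite !mulr_ge0 ?ler0n.
  have h1 x y z w : x \notin level_set -> Q x * (Q y * Q z * Q w) <= level * (Q y * Q z * Q w).
    by rewrite inE -ltNge => h; apply: ler_wpM2r => //; exact: ltW.
  have [aA|/h1 h] := boolP (a \in level_set); last first.
    have := h b c d; have := mulr_ge0 (ltW dl0) (QQ a c d).
    have := mulr_ge0 (ltW dl0) (QQ a b d); have := mulr_ge0 (ltW dl0) (QQ a b c).
    by rewrite !mulrDr !mulrA in h II *; lra.
  have [bA|/h1 h] := boolP (b \in level_set); last first.
    have := h a c d; have := mulr_ge0 (ltW dl0) (QQ b c d).
    have := mulr_ge0 (ltW dl0) (QQ a b d); have := mulr_ge0 (ltW dl0) (QQ a b c).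
    by rewrite [Q a * Q b * Q c * Q d](_ : _ = Q b * (Q a * Q c * Q d)); [rewrite !mulrDr; lra|ring].
  have [cA|/h1 h] := boolP (c \in level_set); last first.
    have := h a b d; have := mulr_ge0 (ltW dl0) (QQ b c d).
    have := mulr_ge0 (ltW dl0) (QQ a c d); have := mulr_ge0 (ltW dl0) (QQ a b c).
    by rewrite [Q a * Q b * Q c * Q d](_ : _ = Q c * (Q a * Q b * Q d)); [rewrite !mulrDr; lra|ring].
  have [dA|/h1 h] := boolP (d \in level_set); last first.
    have := h a b c; have := mulr_ge0 (ltW dl0) (QQ b c d).
    have := mulr_ge0 (ltW dl0) (QQ a c d); have := mulr_ge0 (ltW dl0) (QQ a b d).
    by rewrite [Q a * Q b * Q c * Q d](_ : _ = Q d * (Q a * Q b * Q c)); [rewrite !mulrDr; lra|ring].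
  rewrite /I aA bA cA dA !mul1r.
  apply: (@le_trans _ _ 1); last by rewrite lerDl mulr_ge0 ?addr_ge0 ?(ltW dl0).
  by do 3 (apply: mulr_ile1 => //; rewrite ?mulr_ge0 //).
have S3 : \sum_a \sum_b \sum_c Q a * Q b * Q c <= N ^+ 3.
  have -> : \sum_a \sum_b \sum_c Q a * Q b * Q c = (\sum_g Q g) ^+ 3.
    rewrite !exprS expr0 mulr1 mulr_suml; apply: eq_bigr => a _.
    rewrite mulr_suml mulr_sumr; apply: eq_bigr => b _.
    by rewrite !mulr_sumr; apply: eq_bigr => c _; rewrite mulrA.
  by apply: lerXn2r; rewrite ?nnegrE ?sumr_ge0 // ltW.
have T1 : \sum_a \sum_b \sum_c Q a * Q b * Q (a + b + c) = \sum_a \sum_b \sum_c Q a * Q b * Q c.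
  apply: eq_bigr => a _; apply: eq_bigr => b _.
  by rewrite [RHS](reindex_inj (@addrI _ (a + b))).
have T2 : \sum_a \sum_b \sum_c Q a * Q c * Q (a + b + c) = \sum_a \sum_b \sum_c Q a * Q b * Q c.
  under eq_bigr do rewrite exchange_big /=.
  rewrite -T1; apply: eq_bigr => a _; apply: eq_bigr => b _; apply: eq_bigr => c _.
  by rewrite addrAC.
have T3 : \sum_a \sum_b \sum_c Q b * Q c * Q (a + b + c) = \sum_a \sum_b \sum_c Q a * Q b * Q c.
  rewrite exchange_big /=; under eq_bigr do rewrite exchange_big /=.
  rewrite -T1; apply: eq_bigr => a _; apply: eq_bigr => b _; apply: eq_bigr => c _.
  by rewrite -addrA [c + _]addrC.
have main : \sum_a \sum_b \sum_c Q a * Q b * Q c * Q (a + b + c) <=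
   \sum_(a in level_set) \sum_(b in level_set) (reps (a + b))%:R + level * (4 * N ^+ 3).
  rewrite EA; apply: (@le_trans _ _ (\sum_a \sum_b \sum_c (I a * I b * I c * I (a + b + c) +
     level * (Q b * Q c * Q (a + b + c) + Q a * Q c * Q (a + b + c)
         + Q a * Q b * Q (a + b + c) + Q a * Q b * Q c)))).
    by apply: ler_sum => a _; apply: ler_sum => b _; apply: ler_sum => c _.
  under eq_bigr do under eq_bigr do rewrite big_split /= -mulr_sumr !big_split /=.
  under eq_bigr do rewrite big_split /= -mulr_sumr !big_split /=.
  rewrite big_split /= -mulr_sumr !big_split /= T1 T2 T3 lerD2l.
  by apply: ler_wpM2l; [exact: ltW level_gt0|lra].
move: main; rewrite energyE.
have : N ^+ 2 * (e ^+ 3 / 8 * N) <= N ^+ 2 * \sum_w Q w ^+ 4.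
  by apply: ler_wpM2l; [exact: sqr_ge0|exact: sum_pow4].
have -> : N ^+ 2 * (e ^+ 3 / 8 * N) = e ^+ 3 / 8 * N ^+ 3 by ring.
rewrite /level; lra.
Qed.

(** Chosen so that pairs with unpopular sum account for at most half of the energy [e^3 / 16 * N^3]
    of the level set, whose size is at most [N / level]. *)
Definition popularity := e ^+ 3 * level ^+ 2 / 32.
Definition popular := [set z | popularity * N <= (reps z)%:R].
Definition popular_pairs := [set w : G * G | [&& w.1 \in level_set, w.2 \in level_set & w.1 + w.2 \in popular]].

Lemma popularity_gt0 : 0 < popularity.
Proof. by rewrite divr_gt0 // mulr_gt0 ?exprn_gt0 ?level_gt0. Qed.

Lemma card_popular_pairs : e ^+ 3 / 32 * N ^+ 3 <= #|popular_pairs|%:R * #|level_set|%:R.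
Proof.
have dl0 := level_gt0.
have := energy_level_set.
have : \sum_(a in level_set) \sum_(b in level_set) (reps (a + b))%:R <=
   \sum_(a in level_set) \sum_(b in level_set) (((a + b) \in popular)%:R * #|level_set|%:R + popularity * N).
  apply: ler_sum => a _; apply: ler_sum => b _.
  have [_|/negbTE] := boolP (a + b \in popular).
    rewrite mul1r; apply: (@le_trans _ _ #|level_set|%:R); last by rewrite lerDl mulr_ge0 ?ltW ?popularity_gt0.
    by rewrite ler_nat /reps; apply: subset_leq_card; apply/subsetP => x; rewrite inE => /andP[].
  by rewrite inE mul0r add0r => /negbT; rewrite -ltNge; exact: ltW.
under [X in _ <= X -> _]eq_bigr do rewrite big_split /= -mulr_suml sumr_const.
rewrite big_split /= -mulr_suml sumr_const.
have -> : \sum_(a in level_set) \sum_(b in level_set) (a + b \in popular)%:R = #|popular_pairs|%:R :> R.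
  rewrite -sum_indicator; transitivity (\sum_a \sum_b ((a, b) \in popular_pairs)%:R : R); last first.
    by rewrite pair_bigA /=; apply: eq_bigr => -[].
  rewrite big_mkcond /=; apply: eq_bigr => a _.
  have [aA|/negbTE aA] := boolP (a \in level_set); last first.
    by rewrite big1 // => b _; rewrite in_set /= aA.
  rewrite big_mkcond /=; apply: eq_bigr => b _; rewrite [(a, b) \in popular_pairs]in_set /= aA.
  by case: (b \in level_set).
have -> : popularity * N *+ #|level_set| *+ #|level_set| = e ^+ 3 / 32 * (#|level_set|%:R * level) ^+ 2 * N.
  by rewrite -[_ *+ _]mulr_natr -[popularity * N *+ _]mulr_natr /popularity; ring.
have : e ^+ 3 / 32 * (#|level_set|%:R * level) ^+ 2 * N <= e ^+ 3 / 32 * N ^+ 3.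
  rewrite [N ^+ 3](_ : _ = N ^+ 2 * N); last by ring.
  rewrite mulrA; apply: ler_wpM2r; first exact: ltW.
  apply: ler_wpM2l; first by rewrite ltW // divr_gt0 // exprn_gt0.
  apply: lerXn2r; [|rewrite nnegrE; exact: ltW|exact: card_level_set].
  by rewrite nnegrE; apply: mulr_ge0 => //; exact: ltW.
lra.
Qed.

Lemma card_popular : #|popular|%:R * (popularity * N) <= #|level_set|%:R ^+ 2.
Proof.
apply: (@le_trans _ _ (\sum_z (reps z)%:R)).
  rewrite [leRHS](bigID (mem popular)) /=.
  apply: (@le_trans _ _ (\sum_(z in popular) (reps z)%:R)); last by rewrite lerDl sumr_ge0.
  by rewrite -sum1_card natr_sum mulr_suml; apply: ler_sum => z; rewrite inE mul1r; exact.
rewrite /reps; under eq_bigr do rewrite -sum_indicator.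
rewrite exchange_big /=.
have -> : #|level_set|%:R ^+ 2 = \sum_a (a \in level_set)%:R * #|level_set|%:R :> R.
  by rewrite -mulr_suml sum_indicator expr2.
apply: ler_sum => a _; have [aA|/negbTE aA] := boolP (a \in level_set); last first.
  by rewrite big1 ?mul0r // => z _; rewrite in_set aA.
rewrite mul1r -(sum_indicator R level_set) [leRHS](reindex_inj (addIr (- a))) /=.
by apply: ler_sum => z _; rewrite in_set aA.
Qed.

(* The exponent: with L = ln (64 / e), the extracted set A' has doubling e^{60 L}, so
   [pfr] costs 44 * 60 L; |A'| >= e^{-9 L} N and Q >= e^{-3 L} on A' cost 12 L. *)
Lemma exists_subgroup : exists H : {set G},
  [/\ 0 \in H, {in H &, forall x y, x + y \in H},
   #|H|%:R <= expR (2652 * ln (64 / e)) * N &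
   expR (- (2652 * ln (64 / e))) * N <= \sum_(g in H) Q g].
Proof.
(* The factor 64 lets [L] absorb all numerical constants, leaving integer multiples of [L] as error
   terms. *)
pose L := ln (64 / e); rewrite -/L.
have dl0 := level_gt0; have th0 := popularity_gt0; have e1 := density_le1.
have e30 : 0 < e ^+ 3 / 32 by rewrite divr_gt0 // exprn_gt0.
have Le : ln e = ln 64 - L by rewrite /L ln_div ?posrE //; lra.
have l64 : ln 64 = ln 2 *+ 6 :> R by rewrite -lnXn //; congr ln; ring.
have l32 : ln 32 = ln 2 *+ 5 :> R by rewrite -lnXn //; congr ln; ring.
have l2 : 0 <= ln 2 :> R by apply: ln_ge0; lra.
have ldl : - (3 * L) <= ln level.
  by rewrite /level ln_div ?posrE ?exprn_gt0 // lnXn // Le; lra.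
have lth : - (9 * L) <= ln popularity.
  have p3 : 0 < e ^+ 3 by exact: exprn_gt0.
  have p2 : 0 < level ^+ 2 by exact: exprn_gt0.
  have p : 0 < e ^+ 3 * level ^+ 2 by exact: mulr_gt0.
  by rewrite /popularity ln_div ?posrE // (lnM p3 p2) !lnXn // Le; lra.
have le3 : - (3 * L) <= ln (e ^+ 3 / 32).
  by rewrite ln_div ?posrE ?exprn_gt0 // lnXn // Le; lra.
have DA0 : 0 < #|popular_pairs|%:R * #|level_set|%:R :> R.
  by apply: lt_le_trans card_popular_pairs; rewrite mulr_gt0 // exprn_gt0.
have A0 : 0 < #|level_set|%:R :> R.
  by rewrite lt_neqAle ler0n andbT; apply: contraTneq DA0 => <-; rewrite mulr0 ltxx.
have D0 : 0 < #|popular_pairs|%:R :> R by move: DA0; rewrite pmulr_lgt0.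
have lA : ln #|level_set|%:R <= ln N + 3 * L.
  have p : 0 < #|level_set|%:R * level by exact: mulr_gt0.
  by have := card_level_set; rewrite -ler_ln ?posrE // lnM ?posrE //; lra.
have lD : 2 * ln N - 6 * L <= ln #|popular_pairs|%:R.
  have N3 : 0 < N ^+ 3 by exact: exprn_gt0.
  have p : 0 < e ^+ 3 / 32 * N ^+ 3 by exact: mulr_gt0.
  have := card_popular_pairs; rewrite -ler_ln ?posrE // (lnM e30 N3) (lnM D0 A0).
  by rewrite lnXn //; lra.
have D0' : (0 < #|popular_pairs|)%N by rewrite -(ltr0n R).
have [z [zP B0 dbl]] := @balog_szemeredi_gowers R G char2 level_set popular D0'.
set A' := [set a in level_set | _] in B0 dbl.
have P0 : 0 < #|popular|%:R :> R by rewrite ltr0n; apply/card_gt0P; exists z.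
have B0' : 0 < #|A'|%:R :> R by rewrite ltr0n.
have lP : ln #|popular|%:R <= ln N + 15 * L.
  have p1 : 0 < popularity * N by exact: mulr_gt0.
  have p2 : 0 < #|popular|%:R * (popularity * N) by exact: mulr_gt0.
  have := card_popular; rewrite -ler_ln ?posrE ?exprn_gt0 // (lnM P0 p1) (lnM th0 N0).
  by rewrite lnXn //; lra.
have lB : ln N - 9 * L <= ln #|A'|%:R.
  have : popularity * N <= #|A'|%:R by move: zP; rewrite inE.
  have p1 : 0 < popularity * N by exact: mulr_gt0.
  by rewrite -ler_ln ?posrE // lnM ?posrE //; lra.
have lB2 : ln #|A'|%:R <= ln #|level_set|%:R :> R.
  rewrite ler_ln ?posrE // ler_nat; apply: subset_leq_card.
  by apply/subsetP => x; rewrite inE => /andP[].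
(* The main terms in [ln N] cancel, and [4 * 3 + 3 * 6 + 2 * 15 = 60]. *)
have dbl' : entl (conv (unif A') (unif A')) <= ln #|A'|%:R + 60 * L by lra.
have [H [c [H0 HD cH cB]]] := pfr char2 B0 dbl'.
exists H; split=> //.
  have Hp : 0 < #|H|%:R :> R by rewrite ltr0n; apply/card_gt0P; exists 0.
  have E x : 0 < expR x :> R := expR_gt0 x.
  have p x : 0 < expR x * N by exact: mulr_gt0.
  have p' x : 0 < expR x * #|A'|%:R :> R by exact: mulr_gt0.
  move: cH; rewrite -ler_ln ?posrE // => cH; rewrite -ler_ln ?posrE //; move: cH.
  by rewrite (lnM (E _) N0) (lnM (E _) B0') !expRK; lra.
apply: le_trans (coset_le c H0 HD).
apply: (@le_trans _ _ (level * #|[set x in A' | x - c \in H]|%:R)).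
  apply: (@le_trans _ _ (level * (expR (- (44 * (60 * L))) * #|A'|%:R))).
    have E x : 0 < expR x :> R := expR_gt0 x.
    have p x : 0 < expR x * N by exact: mulr_gt0.
    have p' x : 0 < expR x * #|A'|%:R :> R by exact: mulr_gt0.
    have p'' x : 0 < level * (expR x * #|A'|%:R) by exact: mulr_gt0.
    rewrite -ler_ln ?posrE //.
    by rewrite (lnM (E _) N0) (lnM dl0 (p' _)) (lnM (E _) B0') !expRK; lra.
  by apply: ler_wpM2l => //; exact: ltW.
rewrite -sum_indicator mulr_sumr [leRHS]big_mkcond /= (reindex_inj (addIr c)) /=.
apply: ler_sum => g _; rewrite in_set addrK.
case: (g \in H); last by rewrite andbF mulr0.
rewrite andbT; have [|_] := boolP (g + c \in A'); last by rewrite mulr0.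
by rewrite mulr1 in_set => /andP[]; rewrite in_set.
Qed.

End SelfDual.

(** * The self-dual weight of a function *)

Section Fourier.
Variables (R : realType) (n : nat).
Local Notation V := 'rV['F_2]_n.
Local Notation C := R[i].
Implicit Types (f g : V -> C) (x y h k xi : V).

Definition nsq (z : C) : R := complex.Re z ^+ 2 + complex.Im z ^+ 2.

Lemma nsqE z : (nsq z)%:C = z * z^*.
Proof.
case: z => a b; rewrite /nsq /=.
by apply/eqP; rewrite eq_complex /=; apply/andP; split; apply/eqP; ring.
Qed.

Lemma nsq_ge0 z : 0 <= nsq z.
Proof. by rewrite addr_ge0 // sqr_ge0. Qed.

Lemma nsq_norm z : (nsq z)%:C = `|z| ^+ 2.
Proof. by rewrite nsqE normCK. Qed.

Lemma sgn_conj a : (sgn C a)^* = sgn C a.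
Proof. by case: (sgnP C a) => ->; rewrite ?rmorphN rmorph1. Qed.

Lemma sgnC a : (sgn R a)%:C = sgn C a.
Proof. by rewrite /sgn rmorphXn rmorphN rmorph1. Qed.

Let N : C := 2 ^+ n.
Let N_neq0 : N != 0. Proof. by rewrite expf_neq0 // pnatr_eq0. Qed.
Let N_conj : (N^-1)^* = N^-1. Proof. by rewrite fmorphV rmorphXn rmorph_nat. Qed.

Definition ft g xi : C := (2 ^+ n)^-1 * \sum_x g x * sgn C (dot x xi).
Definition corr g k : C := (2 ^+ n)^-1 * \sum_x g x * (g (x + k))^*.

Lemma addV_eq0 x y : x + y = 0 -> x = y.
Proof. by move=> e; rewrite -[x]addr0 -(addVV y) addrA e add0r. Qed.

(** Orthogonality in [xi] keeps only the pairs with [y = x + k]: the squared spectrum and the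
    autocorrelation are Fourier transforms of each other. *)
Lemma wiener g k :
  \sum_xi ft g xi * (ft g xi)^* * sgn C (dot xi k) = corr g k.
Proof.
rewrite /ft /corr -/N.
transitivity (N^-1 * N^-1 * \sum_x \sum_y g x * (g y)^* * \sum_xi sgn C (dot xi (x + y + k))).
  under [in RHS]eq_bigr do under eq_bigr do rewrite mulr_sumr.
  under [in RHS]eq_bigr do rewrite exchange_big /=.
  rewrite exchange_big /= mulr_sumr; apply: eq_bigr => xi _.
  rewrite rmorphM /= N_conj rmorph_sum /= mulrACA -[LHS]mulrA; congr (_ * _).
  rewrite mulr_suml mulr_suml; apply: eq_bigr => x _.
  rewrite mulr_sumr mulr_suml; apply: eq_bigr => y _.
  rewrite rmorphM /= sgn_conj !dotDr !sgnD (dotC xi x) (dotC xi y); ring.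
rewrite -mulrA; congr (_ * _); rewrite mulr_sumr; apply: eq_bigr => x _.
under eq_bigr do rewrite sum_sgn.
rewrite (bigD1 (x + k)) //= big1 ?addr0 => [|y yk].
  rewrite (_ : x + (x + k) + k = 0); last by rewrite addrA addVV add0r addVV.
  by rewrite eqxx mulrCA mulVf ?mulr1.
rewrite ifN ?mulr0 //; apply: contra yk => /eqP e; apply/eqP/esym/addV_eq0.
by rewrite -e addrAC.
Qed.

Lemma parseval g : \sum_xi nsq (ft g xi) = (2 ^+ n)^-1 * \sum_x nsq (g x).
Proof.
apply: (@complexI R); rewrite rmorph_sum rmorphM fmorphV rmorphXn rmorph_nat rmorph_sum /=.
transitivity (corr g 0).
  by rewrite -wiener; apply: eq_bigr => xi _; rewrite nsqE dotx0 sgn0 mulr1.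
by rewrite /corr; congr (_ * _); apply: eq_bigr => x _; rewrite addr0 nsqE.
Qed.

Lemma bounded_nsq g x : bounded1 g -> nsq (g x) <= 1.
Proof.
move=> gb; rewrite -(lecR (nsq _)) nsq_norm.
by rewrite exprn_ile1 // ; exact: gb.
Qed.

Lemma parseval_le1 g : bounded1 g -> \sum_xi nsq (ft g xi) <= 1.
Proof.
move=> gb; rewrite parseval ler_pdivrMl ?exprn_gt0 // mulr1.
rewrite -(card_V n R) -sum1_card natr_sum; apply: ler_sum => x _; exact: bounded_nsq.
Qed.

(** Parseval's identity for the squared spectrum, whose transform is [corr g] by [wiener]. *)
Lemma corr_l2 g :
  \sum_k nsq (corr g k) = 2 ^+ n * \sum_xi nsq (ft g xi) ^+ 2.
Proof.
apply: (@complexI R); rewrite rmorphM rmorphXn rmorph_nat !rmorph_sum /=.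
have W l : \sum_xi (nsq (ft g xi))%:C * sgn C (dot xi l) = corr g l.
  by rewrite -wiener; apply: eq_bigr => xi _; rewrite nsqE.
under eq_bigr do rewrite nsqE -W mulr_suml.
rewrite exchange_big /= mulr_sumr; apply: eq_bigr => xi _.
under eq_bigr do rewrite rmorph_sum mulr_sumr.
rewrite exchange_big /= (bigD1 xi) //= [X in _ + X]big1 ?addr0 => [|zeta ne].
  rewrite (eq_bigr (fun=> ((nsq (ft g xi)) ^+ 2)%:C)) => [|k _].
    by rewrite sumr_const -[_ *+ _]mulr_natr card_V mulrC.
  rewrite rmorphM /= sgn_conj mulrACA sgn_sq mulr1 rmorphXn expr2; congr (_ * _).
  by rewrite /= nsqE rmorphM /= conjCK mulrC.
rewrite (eq_bigr (fun k => (nsq (ft g xi))%:C * ((nsq (ft g zeta))%:C)^* *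
   sgn C (dot k (xi + zeta)))) => [|k _]; last first.
  by rewrite rmorphM /= sgn_conj dotDr sgnD (dotC k xi) (dotC k zeta); ring.
rewrite -mulr_sumr sum_sgn ifN ?mulr0 //; apply: contra ne => /eqP e.
by apply/eqP/esym/addV_eq0.
Qed.

Definition Delta f h x : C := f (x + h) * (f x)^*.

Lemma bounded_Delta f h : bounded1 f -> bounded1 (Delta f h).
Proof.
by move=> fb x; rewrite /Delta normrM norm_conjC mulr_ile1 // ; apply: fb.
Qed.

(** The source of self-duality: both sides average the same product of [f] over the parallelogram
    [x], [x + h], [x + k], [x + h + k]. *)
Lemma corr_Delta_sym f h k : corr (Delta f h) k = corr (Delta f k) h.
Proof.
rewrite /corr; congr (_ * _); apply: eq_bigr => x _.
by rewrite /Delta !rmorphM /= !conjCK (addrAC x k h); ring.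
Qed.

Definition q f h xi : R := nsq (ft (Delta f h) xi).

Lemma q_ge0 f h xi : 0 <= q f h xi. Proof. exact: nsq_ge0. Qed.

Lemma q_sum_le1 f h : bounded1 f -> \sum_xi q f h xi <= 1.
Proof. by move=> fb; apply: parseval_le1; exact: bounded_Delta. Qed.

Lemma q_le1 f h xi : bounded1 f -> q f h xi <= 1.
Proof.
move=> /(q_sum_le1 h); apply: le_trans; rewrite (bigD1 xi) //= lerDl.
by apply: sumr_ge0 => y _; exact: q_ge0.
Qed.

(** The sum over [xi] is [corr (Delta f h) k], which equals [corr (Delta f k) h]; summing over [h]
    inverts the transform. Here [Nxlnx] is a bound frequency and not the entropy function. *)
Lemma q_dual f k Nxlnx :
  q f k Nxlnx = (2 ^+ n)^-1 * \sum_h \sum_xi q f h xi * sgn R (dot xi k + dot h Nxlnx).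
Proof.
apply: (@complexI R); rewrite rmorphM fmorphV rmorphXn rmorph_nat rmorph_sum /=.
have W g l : \sum_xi (nsq (ft g xi))%:C * sgn C (dot xi l) = corr g l.
  by rewrite -wiener; apply: eq_bigr => xi _; rewrite nsqE.
transitivity (N^-1 * \sum_h corr (Delta f k) h * sgn C (dot h Nxlnx)); last first.
  congr (_ * _); apply: eq_bigr => h _; rewrite corr_Delta_sym -W rmorph_sum mulr_suml.
  by apply: eq_bigr => xi _; rewrite rmorphM /= sgnC sgnD mulrA.
under eq_bigr do rewrite -W mulr_suml.
rewrite exchange_big /= mulr_sumr (bigD1 Nxlnx) //= [X in _ = _ + X]big1 ?addr0 => [|xi xe].
  under eq_bigr => h _ do rewrite -mulrA -sgnD (dotC _ h) addFF sgn0 mulr1.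
  by rewrite sumr_const -[_ *+ _]mulr_natr card_V mulrC mulfK.
under eq_bigr => h _ do rewrite -mulrA -sgnD (dotC _ h) -dotDr.
rewrite -mulr_sumr sum_sgn ifN ?mulr0 //; apply: contra xe => /eqP e.
by apply/eqP; exact: addV_eq0.
Qed.

(** For fixed [h], [corr_l2] turns the sum over [xi] into one of squared correlations. In the U^3
    average with two differences fixed, the sums over [x] and [x + h3] separate into the same
    squares. *)
Lemma q_sq f : (\sum_h \sum_xi q f h xi ^+ 2)%:C = 2 ^+ n * gowersU3_avg f.
Proof.
have sq h : (\sum_xi q f h xi ^+ 2)%:C = N^-1 * \sum_k corr (Delta f h) k * (corr (Delta f h) k)^*.
  apply: (mulfI N_neq0); rewrite mulVKf //.
  transitivity ((2 ^+ n * \sum_xi q f h xi ^+ 2)%:C).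
    by rewrite rmorphM rmorphXn rmorph_nat.
  by rewrite -corr_l2 rmorph_sum; apply: eq_bigr => k _; rewrite /= nsqE.
rewrite rmorph_sum /=; under eq_bigr do rewrite sq.
rewrite -mulr_sumr /gowersU3_avg -/N.
pose D h1 h2 x := f x * (f (x + h1))^* * (f (x + h2))^* * f (x + h1 + h2).
have cD h k : corr (Delta f h) k = N^-1 * \sum_x D h k x.
  rewrite /corr (reindex_inj (addIr h)) /=; congr (_ * _); apply: eq_bigr => x _.
  rewrite /Delta /D !rmorphM /= conjCK -addrA addVV addr0 (addrAC (x + h)) -(addrA x h h) addVV addr0.
  by rewrite (addrAC x h k); ring.
have -> : \sum_x \sum_h1 \sum_h2 \sum_h3 \prod_(w1 : bool) \prod_(w2 : bool) \prod_(w3 : bool)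
      iter (w1 + w2 + w3) Num.conj (f (x + h1 *+ w1 + h2 *+ w2 + h3 *+ w3)) =
   \sum_h1 \sum_h2 (\sum_x D h1 h2 x) * (\sum_y D h1 h2 y)^*.
  rewrite exchange_big /=; apply: eq_bigr => h1 _.
  rewrite exchange_big /=; apply: eq_bigr => h2 _.
  rewrite mulr_suml; apply: eq_bigr => x _.
  rewrite rmorph_sum mulr_sumr [RHS](reindex_inj (addrI x)) /=.
  apply: eq_bigr => y _.
  rewrite !big_bool /= !mulr0n !mulr1n !addr0 /D !rmorphM /= !conjCK.
  have E z : x + z + y = x + y + z by rewrite addrAC.
  have E2 : x + h1 + h2 + y = x + y + h1 + h2 by rewrite addrAC E.
  by rewrite E2 !E; ring.
have -> : N * ((2 ^+ (4 * n))^-1 * \sum_h1 \sum_h2 (\sum_x D h1 h2 x) * (\sum_y D h1 h2 y)^*) =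
   N^-1 * (N^-1 * N^-1 * \sum_h1 \sum_h2 (\sum_x D h1 h2 x) * (\sum_y D h1 h2 y)^*).
  by rewrite mulnC exprM -/N; field.
congr (_ * _); rewrite mulr_sumr; apply: eq_bigr => h _.
rewrite mulr_sumr; apply: eq_bigr => k _.
by rewrite cD rmorphM /= N_conj mulrACA.
Qed.

End Fourier.

(** * From subgroups to quadratic forms *)

Section SpanSet.
Variables (m : nat) (H : {set 'rV['F_2]_m}).
Hypotheses (H0 : 0 \in H) (HD : {in H &, forall x y, x + y \in H}).

(** Over F_2 a set that contains 0 and is closed under addition is a subspace; as a row space it is
    open to [submx] and [pinvmx]. *)
Definition span_set : 'M['F_2]_(#|H|, m) := \matrix_(i < #|H|) enum_val i.

Lemma span_setP x : (x <= span_set)%MS = (x \in H).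
Proof.
apply/idP/idP => [/submxP[u ->]|xH]; last first.
  have -> : x = row (enum_rank_in xH x) span_set by rewrite rowK enum_rankK_in.
  exact: row_sub.
rewrite mulmx_sum_row; apply: (big_ind (fun y => y \in H)) => // i _.
rewrite rowK; case: (F2P (u 0 i)) => ->; first by rewrite scale0r.
by rewrite scale1r enum_valP.
Qed.

End SpanSet.

Section Graph.
Variables (R : realType) (n : nat) (Q : 'rV['F_2]_(n + n) -> R).
Local Notation V := 'rV['F_2]_n.
Hypothesis Q0 : forall g, 0 <= Q g.
Hypothesis Qcoset : forall (K : {set 'rV['F_2]_(n + n)}) c, 0 \in K ->
  {in K &, forall x y, x + y \in K} -> \sum_(g in K) Q (g + c) <= \sum_(g in K) Q g.
Hypothesis Qvert : forall h : V, \sum_xi Q (row_mx h xi) <= 1.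

Lemma sum_graph (M : 'M['F_2]_n) (U : {set V}) (c : 'rV['F_2]_(n + n)) :
  \sum_(g in [set row_mx h (h *m M) | h in U]) Q (g + c) =
  \sum_(h in U) Q (row_mx h (h *m M) + c).
Proof. by rewrite big_imset //= => h h' _ _ /eq_row_mx[]. Qed.

Lemma sum_graph_coset (M : 'M['F_2]_n) (U : {set V}) (c : 'rV['F_2]_(n + n)) :
  0 \in U -> {in U &, forall x y, x + y \in U} ->
  \sum_(h in U) Q (row_mx h (h *m M) + c) <= \sum_(h in U) Q (row_mx h (h *m M)).
Proof.
move=> U0 UD; rewrite -sum_graph.
have -> : \sum_(h in U) Q (row_mx h (h *m M)) =
   \sum_(g in [set row_mx h (h *m M) | h in U]) Q g.
  by rewrite big_imset //= => h h' _ _ /eq_row_mx[].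
apply: Qcoset.
  by apply/imsetP; exists 0 => //; rewrite mul0mx row_mx0.
move=> x y /imsetP[h hU ->] /imsetP[k kU ->]; apply/imsetP; exists (h + k).
  exact: UD.
by rewrite mulmxDl add_row_mx.
Qed.

(** M is a linear section of the projection of [H] to its first half, so [H] is the sum of the graph
    of [M] over the image [U] and of the vertical part [H1]. Each of the [#|H1|] translates of the
    graph weighs at most [S] by the coset bound, and each of the [#|U|] fibres at most 1; the
    product of the two estimates is the claim. *)
Lemma exists_graph (H : {set 'rV['F_2]_(n + n)}) : 0 \in H ->
  {in H &, forall x y, x + y \in H} -> exists M : 'M['F_2]_n,
  (\sum_(g in H) Q g) ^+ 2 <= #|H|%:R * \sum_h Q (row_mx h (h *m M)).
Proof.
move=> H0 HD; pose A := span_set H.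
pose M := pinvmx (lsubmx A) *m rsubmx A.
pose U := [set h : V | (h <= lsubmx A)%MS].
pose H1 := [set xi : V | row_mx 0 xi \in H].
have AE : A = row_mx (lsubmx A) (rsubmx A) by rewrite hsubmxK.
have UH h : h \in U -> row_mx h (h *m M) \in H.
  rewrite inE => hU; rewrite -(span_setP H0 HD) -/A AE.
  rewrite -[X in row_mx X _](mulmxKpV hU) /M (mulmxA h _ (rsubmx A)) -mul_mx_row.
  exact: submxMl.
have HU g : g \in H -> lsubmx g \in U.
  rewrite inE -(span_setP H0 HD) => /submxP[u ->]; rewrite -/A {1}AE mul_mx_row row_mxKl.
  exact: submxMl.
have U0 : 0 \in U by rewrite inE sub0mx.
have UD : {in U &, forall x y, x + y \in U}.
  by move=> x y; rewrite !inE => hx hy; apply: addmx_sub.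
have dec (F : 'rV['F_2]_(n + n) -> R) :
    \sum_(g in H) F g = \sum_(xi in H1) \sum_(h in U) F (row_mx h (h *m M) + row_mx 0 xi).
  rewrite pair_big /= (reindex_onto (fun p : V * V => row_mx p.2 (p.2 *m M) + row_mx 0 p.1)
    (fun g => (rsubmx g - lsubmx g *m M, lsubmx g))) /= => [|g gH]; last first.
    by rewrite add_row_mx addr0 addrC subrK hsubmxK.
  apply: eq_bigl => -[xi h] /=; rewrite add_row_mx addr0 row_mxKl row_mxKr addrAC subrr add0r.
  rewrite eqxx andbT; apply/idP/andP => [gH|[xiH hU]].
    have hU : h \in U by have := HU _ gH; rewrite row_mxKl.
    split=> //; rewrite inE.
    have := HD _ _ gH (UH _ hU); rewrite add_row_mx addVV (addrAC _ xi) addVV add0r; exact.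
  have := HD _ _ (UH _ hU) (_ : row_mx 0 xi \in H); rewrite add_row_mx addr0; apply.
  by move: xiH; rewrite inE.
pose S := \sum_h Q (row_mx h (h *m M)).
have S1 : \sum_(g in H) Q g <= #|H1|%:R * S.
  rewrite dec -sum1_card natr_sum mulr_suml; apply: ler_sum => xi _; rewrite mul1r.
  apply: le_trans (sum_graph_coset _ _ U0 UD) _.
  by rewrite /S [leRHS](bigID (mem U)) /= lerDl sumr_ge0.
have S2 : \sum_(g in H) Q g <= #|U|%:R.
  rewrite dec exchange_big /= -sum1_card natr_sum; apply: ler_sum => h _.
  apply: le_trans (Qvert h); rewrite [leRHS](reindex_inj (addrI (h *m M))) /=.
  rewrite [leRHS](bigID (mem H1)) /=.
  under eq_bigr do rewrite add_row_mx addr0.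
  by rewrite lerDl sumr_ge0.
have cH : #|H|%:R = #|H1|%:R * #|U|%:R :> R.
  have := dec (fun=> 1); rewrite sumr_const => ->.
  by rewrite (eq_bigr (fun=> #|U|%:R)) => [|xi _]; rewrite sumr_const // -[_ *+ #|_|]mulr_natl.
exists M; rewrite -/S cH expr2 mulrAC; apply: ler_pM => //; exact: sumr_ge0.
Qed.

End Graph.

Section Quadratic.
Variable n : nat.
Local Notation V := 'rV['F_2]_n.

(* With P a projection onto W, take B = P M (1 - P^T) + T where T is the strictly
   upper triangular part of the alternating matrix P M P^T. *)
Lemma exists_quadratic (M : 'M['F_2]_n) (W : {set V}) : 0 \in W ->
  {in W &, forall x y, x + y \in W} ->
  {in W, forall h, h *m M = h *m M^T /\ dot (h *m M) h = 0} ->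
  exists B : 'M['F_2]_n, {in W, forall h, h *m (B + B^T) = h *m M}.
Proof.
move=> W0 WD WM.
have [P PW WP] : exists2 P : 'M['F_2]_n, forall x : V, x *m P \in W &
    {in W, forall h, h *m P = h}.
  pose A := span_set W; exists (pinvmx A *m A) => [x|h hW].
    by rewrite -(span_setP W0 WD) mulmxA; exact: submxMl.
  by rewrite mulmxA mulmxKpV // span_setP.
pose S := P *m M *m P^T.
pose e i : V := delta_mx 0 i.
have Sij i j : S i j = dot (e i *m P *m M) (e j *m P).
  rewrite /dot trmx_mul mulmxA -(mulmxA (e i)) -(mulmxA (e i)) -rowE.
  by rewrite trmx_delta -colE !mxE.
have Ssym i j : S i j = S j i.
  by rewrite !Sij dot_mul -(WM _ (PW (e j))).1 dotC.
(* A matrix of the form [T + T^T] has zero diagonal here, which is why the form [dot (h *m M) h] has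
   to vanish on [W]. *)
have Sdiag i : S i i = 0 by rewrite Sij (WM _ (PW (e i))).2.
pose T : 'M['F_2]_n := \matrix_(i, j) if (i < j)%N then S i j else 0.
have TS : T + T^T = S.
  have TE i j : T i j = if (i < j)%N then S i j else 0 by rewrite mxE.
  apply/matrixP => i j; rewrite [LHS]mxE [X in _ + X]mxE !TE; case: ltngtP => [ij|ji|/val_inj ->].
  - by rewrite addr0.
  - by rewrite add0r Ssym.
  - by rewrite addr0 Sdiag.
(* On [W] the factor [1 - P] annihilates the transposed term, and [T + T^T] restores the [h M P^T]
   subtracted by the first. *)
exists (P *m M *m (1%:M - P^T) + T) => h hW.
have -> : (P *m M *m (1%:M - P^T) + T)^T = (1%:M - P) *m M^T *m P^T + T^T.
  by rewrite linearD /= !trmx_mul linearB /= trmx1 trmxK mulmxA.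
rewrite addrACA TS /S !mulmxDr !mulmxA !mulmxBr !mulmx1 WP // subrr !mul0mx addr0.
by rewrite mulmxN subrK.
Qed.

End Quadratic.

(** * Symmetry of the linear map on a large subspace *)

Section Symmetry.
Variables (R : realType) (n : nat).
Local Notation V := 'rV['F_2]_n.
Local Notation C := R[i].
Implicit Types (f g : V -> C).

Lemma sqr_sum_le (T : finType) (F : T -> R) : (\sum_x F x) ^+ 2 <= #|T|%:R * \sum_x F x ^+ 2.
Proof.
have : 0 <= \sum_x \sum_y (F x - F y) ^+ 2.
  by apply: sumr_ge0 => x _; apply: sumr_ge0 => y _; exact: sqr_ge0.
have -> : \sum_x \sum_y (F x - F y) ^+ 2 =
    2 * (#|T|%:R * \sum_x F x ^+ 2) - 2 * (\sum_x F x) ^+ 2.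
  transitivity (\sum_x (#|T|%:R * F x ^+ 2 - 2 * (F x * \sum_y F y) + \sum_y F y ^+ 2)).
    apply: eq_bigr => x _.
    rewrite (eq_bigr (fun y => F x ^+ 2 - 2 * F x * F y + F y ^+ 2)) => [|y _]; last by ring.
    rewrite big_split /= sumrB sumr_const -[_ *+ _]mulr_natl -mulr_sumr.
    by rewrite mulrA.
  rewrite big_split /= sumrB sumr_const -[_ *+ #|_|]mulr_natl -!mulr_sumr -mulr_suml.
  by ring.
lra.
Qed.

Lemma nsqM (a b : C) : nsq (a * b) = nsq a * nsq b.
Proof. by case: a b => a1 a2 [b1 b2]; rewrite /nsq /=; ring. Qed.

Lemma nsq_conj (a : C) : nsq a^* = nsq a.
Proof. by case: a => a1 a2; rewrite /nsq /= sqrrN. Qed.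

Lemma nsq_sgn a : nsq (sgn C a) = 1.
Proof. by case: (sgnP C a) => ->; rewrite /nsq /= ?oppr0 ?sqrrN expr1n expr0n addr0. Qed.

Lemma nsq_sum_le (w : V -> C) : nsq (\sum_x w x) <= 2 ^+ n * \sum_x nsq (w x).
Proof.
rewrite /nsq (raddf_sum (@complex.Re R)) (raddf_sum (@complex.Im R)) big_split /= mulrDr.
by rewrite -(card_V n R); apply: lerD; exact: sqr_sum_le.
Qed.

Lemma nsq_sum_le1 (w z : V -> C) : (forall x, nsq (w x) <= 1) ->
  nsq (\sum_x w x * z x) <= 2 ^+ n * \sum_x nsq (z x).
Proof.
move=> h; apply: le_trans (nsq_sum_le _) _.
rewrite ler_pM2l ?exprn_gt0 //; apply: ler_sum => x _.
by rewrite nsqM -[leRHS]mul1r ler_wpM2r // nsq_ge0.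
Qed.

(** Each frequency is hit by at most as many [y] as the kernel of [S] has elements, and the squared
    coefficients sum to at most 1. *)
Lemma sum_ft_mul (g : V -> C) (S : 'M['F_2]_n) : bounded1 g ->
  \sum_y nsq (ft g (y *m S)) <= #|[set y : V | y *m S == 0]|%:R.
Proof.
move=> gb; rewrite (partition_big (fun y : V => y *m S) predT) //=.
rewrite -[leRHS]mulr1.
apply: (@le_trans _ _ (#|[set y : V | y *m S == 0]|%:R * \sum_xi nsq (ft g xi))); last first.
  by apply: ler_wpM2l => //; exact: parseval_le1.
rewrite mulr_sumr; apply: ler_sum => xi _.
rewrite (eq_bigr (fun=> nsq (ft g xi))) => [|y /eqP -> //].
rewrite sumr_const -[_ *+ _]mulr_natl; apply: ler_wpM2r; first exact: nsq_ge0.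
rewrite ler_nat.
have [/existsP[y0 /eqP e0]|/existsPn no] := boolP [exists y : V, y *m S == xi]; last first.
  by rewrite eq_card0 // => y; have := no y; rewrite !inE => /negbTE.
rewrite -(card_imset _ (addIr y0)); apply: subset_leq_card; apply/subsetP => z.
move=> /imsetP[y yS ->]; have ey : y *m S = xi by apply/eqP; exact: yS.
by rewrite inE mulmxDl ey e0 addVV.
Qed.

(* The sum of q(h, hM) is a trilinear form in f, f and h |-> conj of the Fourier
   coefficient, with phase (-1)^{hM.x}; one Cauchy-Schwarz and the substitution
   x = z + y + y' leave the bilinear phase (-1)^{y(M + M^T).y'} for each z. *)
Lemma kernel_large f (M : 'M['F_2]_n) (d : R) : bounded1 f -> 0 <= d ->
  d * 2 ^+ n <= \sum_h q f h (h *m M) ->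
  d ^+ 4 * 2 ^+ n <= #|[set h : V | h *m M == h *m M^T]|%:R.
Proof.
move=> fb d0 hd.
set K := #|_|%:R.
pose N : R := 2 ^+ n.
have N0 : 0 < N by exact: exprn_gt0.
pose B (h x : V) := dot (h *m M) x.
have BDl x y z : B (x + y) z = B x z + B y z by rewrite /B mulmxDl dotDl.
have BDr x y z : B z (x + y) = B z x + B z y by rewrite /B dotDr.
pose b h := (ft (Delta f h) (h *m M))^*.
have fb1 x : nsq (f x) <= 1 by exact: bounded_nsq.
have bb1 h : nsq (b h) <= 1.
  by rewrite nsq_conj; exact: q_le1.
pose Z x := \sum_y f y * b (x + y) * sgn C (B y x).
have bs (g : V -> C) : (forall x, nsq (g x) <= 1) -> bounded1 g.
  move=> h x; rewrite -(@ler_pXn2r _ 2) ?nnegrE // expr1n -nsq_norm.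
  by rewrite (_ : 1 = 1%:C) // lecR.
have T1 : (N * \sum_h q f h (h *m M))%:C = \sum_x ((f x)^* * sgn C (B x x)) * Z x.
  rewrite rmorphM rmorph_sum /=.
  transitivity (\sum_h b h * \sum_x Delta f h x * sgn C (dot x (h *m M))).
    rewrite mulr_sumr; apply: eq_bigr => h _; rewrite nsqE -/(b h) [in RHS]mulrC mulrA; congr (_ * _).
    by rewrite /ft mulrA rmorphXn rmorph_nat mulfV ?mul1r // expf_neq0 // pnatr_eq0.
  under [in LHS]eq_bigr do rewrite mulr_sumr.
  rewrite [LHS]exchange_big /=; apply: eq_bigr => x _.
  rewrite [LHS](reindex_inj (addrI x)) /= mulr_sumr; apply: eq_bigr => y _.
  rewrite /Delta addrA addVV add0r (dotC x) -/(B (x + y) x) BDl sgnD; ring.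
have T2 : (N * \sum_h q f h (h *m M)) ^+ 2 <= N * \sum_x nsq (Z x).
  have -> : (N * \sum_h q f h (h *m M)) ^+ 2 = nsq (N * \sum_h q f h (h *m M))%:C.
    by rewrite /nsq /= [0 ^+ 2]expr0n addr0.
  rewrite T1; apply: nsq_sum_le1 => x.
  by rewrite nsqM nsq_sgn mulr1 nsq_conj.
pose g z y := f y * (b (z + y))^* * sgn C (B y z + B y y).
have g1 z y : nsq (g z y) <= 1.
  by rewrite !nsqM nsq_sgn nsq_conj mulr1 mulr_ile1 ?nsq_ge0.
pose W z := \sum_y g z y * \sum_y' (g z y')^* * sgn C (dot y' (y *m (M + M^T))).
have ZW : (\sum_x nsq (Z x))%:C = \sum_z W z.
  rewrite rmorph_sum /=.
  transitivity (\sum_x \sum_y \sum_y' f y * b (x + y) * (f y')^* * (b (x + y'))^* *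
     sgn C (B y x + B y' x)).
    apply: eq_bigr => x _; rewrite nsqE {2}/Z rmorph_sum mulr_suml; apply: eq_bigr => y _.
    rewrite mulr_sumr; apply: eq_bigr => y' _.
    by rewrite !rmorphM /= sgn_conj sgnD; ring.
  rewrite exchange_big /=.
  transitivity (\sum_y \sum_z \sum_y' g z y * ((g z y')^* * sgn C (dot y' (y *m (M + M^T))))); last first.
    rewrite exchange_big /=; apply: eq_bigr => z _; apply: eq_bigr => y _.
    by rewrite mulr_sumr.
  apply: eq_bigr => y _; rewrite exchange_big [RHS]exchange_big /=; apply: eq_bigr => y' _.
  rewrite (reindex_inj (addIr (y + y'))) /=; apply: eq_bigr => z _.
  have -> : z + (y + y') + y = z + y' by rewrite (addrC y) -!addrA addVV addr0.
  have -> : z + (y + y') + y' = z + y by rewrite -!addrA addVV addr0.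
  have -> : dot y' (y *m (M + M^T)) = B y y' + B y' y.
    by rewrite mulmxDr dotDr (dotC y') -/(B y y') [X in _ = _ + X]/B dot_mul.
  rewrite /g !rmorphM /= conjCK sgn_conj !BDr !sgnD; ring.
have hker : [set y : V | y *m (M + M^T) == 0] = [set h : V | h *m M == h *m M^T].
  apply/setP => y; rewrite !inE mulmxDr addr_eq0.
  have -> // : - (y *m M^T) = y *m M^T.
  by apply/eqP; rewrite eq_sym -subr_eq0 opprK addVV.
(* Cauchy-Schwarz in [y] removes the bounded factor [g z y]. The inner sum is [N] times a Fourier
   coefficient at [y (M + M^T)], so only the size of the kernel of [M + M^T] remains. *)
have W1 z : nsq (W z) <= N ^+ 3 * K.
  apply: le_trans (nsq_sum_le1 _ (g1 z)) _.
  have -> : \sum_x nsq (\sum_y' (g z y')^* * sgn C (dot y' (x *m (M + M^T)))) =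
     N ^+ 2 * \sum_x nsq (ft (fun y => (g z y)^*) (x *m (M + M^T))).
    rewrite mulr_sumr; apply: eq_bigr => x _.
    rewrite /ft nsqM mulrA (_ : N ^+ 2 * _ = 1) ?mul1r //.
    have -> : (2 ^+ n)^-1 = (N^-1)%:C :> C by rewrite fmorphV rmorphXn rmorph_nat.
    by rewrite /nsq /= [0 ^+ 2]expr0n addr0 -exprMn mulfV ?expr1n // gt_eqF.
  rewrite -/N (_ : N ^+ 3 * K = N * (N ^+ 2 * K)); last by ring.
  rewrite ler_pM2l // ler_pM2l ?exprn_gt0 // /K -hker.
  by apply: sum_ft_mul; apply: bs => x; rewrite nsq_conj.
have WW : (\sum_x nsq (Z x)) ^+ 2 <= N ^+ 5 * K.
  have -> : (\sum_x nsq (Z x)) ^+ 2 = nsq (\sum_x nsq (Z x))%:C.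
    by rewrite /nsq /= [0 ^+ 2]expr0n addr0.
  rewrite ZW; apply: le_trans (nsq_sum_le _) _; rewrite -/N.
  apply: (@le_trans _ _ (N * \sum_(x : V) N ^+ 3 * K)).
    by rewrite ler_pM2l //; apply: ler_sum.
  rewrite sumr_const -[_ *+ _]mulr_natl card_V -/N le_eqVlt; apply/orP; left; apply/eqP; ring.
have h1 : d ^+ 2 * N ^+ 3 <= \sum_x nsq (Z x).
  rewrite -(ler_pM2l N0); apply: le_trans T2.
  have -> : N * (d ^+ 2 * N ^+ 3) = (N * (d * N)) ^+ 2 by ring.
  by apply: lerXn2r; rewrite ?nnegrE ?mulr_ge0 ?sumr_ge0 ?(ltW N0) ?ler_pM2l // => *; exact: q_ge0.
have h2 : (d ^+ 2 * N ^+ 3) ^+ 2 <= N ^+ 5 * K.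
  apply: le_trans WW; apply: lerXn2r => //; rewrite nnegrE.
    by rewrite mulr_ge0 ?sqr_ge0 // exprn_ge0 // ltW.
  by apply: sumr_ge0 => x _; exact: nsq_ge0.
have N5 : 0 < N ^+ 5 by exact: exprn_gt0.
rewrite -(ler_pM2l N5); apply: le_trans h2; rewrite -/N.
by rewrite le_eqVlt; apply/orP; left; apply/eqP; ring.
Qed.

End Symmetry.

(** * Assembly of the inverse theorem *)

Section Inverse.
Variables (R : realType) (n : nat).
Local Notation V := 'rV['F_2]_n.
Local Notation C := R[i].
Local Notation N := (2 ^+ n : R).
Implicit Types f : V -> C.

Definition qpair f (g : 'rV['F_2]_(n + n)) : R := q f (lsubmx g) (rsubmx g).

Definition symp (w g : 'rV['F_2]_(n + n)) : R :=
  sgn R (dot (rsubmx w) (lsubmx g) + dot (lsubmx w) (rsubmx g)).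

Lemma sum_row_mx (F : 'rV['F_2]_(n + n) -> R) :
  \sum_g F g = \sum_h \sum_xi F (row_mx h xi).
Proof.
rewrite pair_bigA /= (reindex (fun p : V * V => row_mx p.1 p.2)) //=.
exists (fun g => (lsubmx g, rsubmx g)) => [[h xi]|g] _ /=.
  by rewrite row_mxKl row_mxKr.
by rewrite hsubmxK.
Qed.

Lemma qpair_row f h xi : qpair f (row_mx h xi) = q f h xi.
Proof. by rewrite /qpair row_mxKl row_mxKr. Qed.

Lemma N_gt0 : 0 < N. Proof. exact: exprn_gt0. Qed.

Lemma sympD w g g' : symp w (g + g') = symp w g * symp w g'.
Proof.
rewrite /symp.
have -> : lsubmx (g + g') = lsubmx g + lsubmx g' by apply/matrixP => i j; rewrite !mxE.
have -> : rsubmx (g + g') = rsubmx g + rsubmx g' by apply/matrixP => i j; rewrite !mxE.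
by rewrite -sgnD !dotDr addrACA.
Qed.

Lemma sympP w g : symp w g = 1 \/ symp w g = -1.
Proof. exact: sgnP. Qed.

Lemma sympC w g : symp w g = symp g w.
Proof. by rewrite /symp addrC (dotC (lsubmx w)) (dotC (rsubmx w)). Qed.

Lemma qpair_ge0 f g : 0 <= qpair f g.
Proof. exact: q_ge0. Qed.

Lemma qpair_dual f g : qpair f g = N^-1 * \sum_w qpair f w * symp w g.
Proof.
rewrite /qpair q_dual sum_row_mx; congr (_ * _).
apply: eq_bigr => h _; apply: eq_bigr => xi _.
by rewrite /symp row_mxKl row_mxKr.
Qed.

Definition qpair_coset_le f := coset_le (@addVV 1 (n + n)) N_gt0 sympD sympP
  (qpair_ge0 f) (qpair_dual f).

Lemma exists_linear f e : bounded1 f -> 0 < e ->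
  e * N <= \sum_g qpair f g ^+ 2 ->
  exists M : 'M['F_2]_n,
    expR (- (3 * (2652 * ln (64 / e)))) * N <= \sum_h q f h (h *m M).
Proof.
move=> fb e0 he.
have le1 g : qpair f g <= 1 by exact: q_le1.
have sumN : \sum_g qpair f g <= N.
  rewrite sum_row_mx -(card_V n R) -sum1_card natr_sum; apply: ler_sum => h _.
  under eq_bigr do rewrite qpair_row.
  exact: q_sum_le1.
have [H [H0 HD cH sH]] := exists_subgroup (@addVV 1 (n + n)) N_gt0 sympD sympP sympC
  (qpair_ge0 f) (qpair_dual f) le1 sumN e0 he.
have vert h : \sum_xi qpair f (row_mx h xi) <= 1.
  by under eq_bigr do rewrite qpair_row; exact: q_sum_le1.
have [M hM] := exists_graph (qpair_ge0 f) (@qpair_coset_le f) vert H0 HD.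
exists M.
have eM : \sum_h qpair f (row_mx h (h *m M)) = \sum_h q f h (h *m M).
  by apply: eq_bigr => h _; rewrite qpair_row.
rewrite eM in hM; set S := \sum_h _ in hM *.
set l := 2652 * _ in cH sH *.
have E x : 0 < expR x :> R := expR_gt0 x.
have S0 : 0 <= S by apply: sumr_ge0 => h _; exact: q_ge0.
(* The square of the lower bound on the mass of [H], divided by the upper bound on its size,
   accounts for the three factors [expR (- l)]. *)
have h1 : (expR (- l) * N) ^+ 2 <= expR l * N * S.
  apply: le_trans (le_trans hM _); last by apply: ler_wpM2r.
  apply: lerXn2r => //; rewrite nnegrE.
    by rewrite mulr_ge0 ?(ltW (E _)) ?(ltW N_gt0).
  by apply: sumr_ge0 => g _; exact: qpair_ge0.
have eN : 0 < expR l * N by rewrite mulr_gt0 ?N_gt0.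
rewrite -(ler_pM2l eN); apply: le_trans h1.
have -> : expR (- (3 * l)) = expR (- l) ^+ 3 by rewrite -expRM_natl; congr expR; ring.
rewrite expRN; have := E l; set t := expR l => t0.
rewrite le_eqVlt; apply/orP; left; apply/eqP; field; exact: lt0r_neq0.
Qed.

(** On the subspace [K] where [M] is symmetric, the cross terms of [dot (h *m M) h] cancel, so this
    form is additive and its zero set [W] has index at most two. The factor [d^4] is the density of
    [K], and one more [d] comes from the average of [q] along the graph. *)
Lemma isotropic f (M : 'M['F_2]_n) d : bounded1 f -> 0 <= d ->
  d * N <= \sum_h q f h (h *m M) ->
  exists B : 'M['F_2]_n,
    d ^+ 5 / 2 * N <= \sum_(h | h *m (B + B^T) == h *m M) q f h (h *m M).
Proof.
move=> fb d0 hd.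
pose K := [set h : V | h *m M == h *m M^T].
pose W := [set h in K | dot (h *m M) h == 0].
have WP h : reflect (h *m M = h *m M^T /\ dot (h *m M) h = 0) (h \in W).
  rewrite in_set [h \in K]in_set; apply: (iffP andP) => [[/eqP ? /eqP ?] //|[-> ->]].
  by rewrite !eqxx.
have quadD h k : h \in K -> k \in K ->
    dot ((h + k) *m M) (h + k) = dot (h *m M) h + dot (k *m M) k.
  rewrite !in_set => /eqP hK /eqP kK; rewrite mulmxDl dotDl !dotDr.
  rewrite (dot_mul M k h) -hK (dotC k) addrA -[dot (h *m M) h + _ + _]addrA addFF addr0.
  by [].
have KD : {in K &, forall x y, x + y \in K}.
  by move=> x y; rewrite !in_set => /eqP hx /eqP hy; rewrite !mulmxDl hx hy.
have WK h : h \in W -> h \in K by rewrite in_set => /andP[].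
have W0 : 0 \in W by apply/WP; rewrite !mul0mx /dot mul0mx mxE.
have WD : {in W &, forall x y, x + y \in W}.
  move=> x y xW yW; rewrite in_set (KD _ _ (WK _ xW) (WK _ yW)) /= quadD ?WK //.
  by have /WP[_ ->] := xW; have /WP[_ ->] := yW; rewrite addr0.
have [B hB] := exists_quadratic W0 WD (fun h hW => elimT (WP h) hW).
exists B.
have cK : (#|K| <= 2 * #|W|)%N.
  have [/exists_inP[w wK ww]|/exists_inPn no] := boolP [exists w in K, dot (w *m M) w != 0].
    have w1 : dot (w *m M) w = 1.
      by case: (F2P (dot (w *m M) w)) => // h; rewrite h eqxx in ww.
    apply: (@leq_trans #|W :|: [set x + w | x in W]|).
      apply: subset_leq_card; apply/subsetP => h hK; rewrite in_setU.
      case: (F2P (dot (h *m M) h)) => hh; apply/orP; [left|right].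
        by rewrite in_set hK hh eqxx.
      apply/imsetP; exists (h + w); last by rewrite -addrA addVV addr0.
      by rewrite in_set KD //= quadD // hh w1 addFF.
    by rewrite mul2n -addnn (leq_trans (leq_card_setU _ _)) // leq_add2l leq_imset_card.
  apply: (@leq_trans #|W|); last by rewrite leq_pmull.
  apply: subset_leq_card; apply/subsetP => h hK; rewrite in_set hK /=.
  by have := no _ hK; rewrite negbK.
have cK' : #|K|%:R <= 2 * #|W|%:R :> R by rewrite -natrM ler_nat.
have kl := kernel_large fb d0 hd; rewrite -/K in kl.
set S := \sum_h _ in hd; set SW := \sum_(h in W) q f h (h *m M).
(* Summed over all [k], the translates by [(k, k M)] of the graph over [W] cover the whole graph
   [#|W|] times, and each weighs at most as much as the graph over [W]. *)
have avg : #|W|%:R * S <= N * SW.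
  have : \sum_(k : V) \sum_(h in W) q f (h + k) ((h + k) *m M) <= \sum_(k : V) SW.
    apply: ler_sum => k _.
    have := sum_graph_coset (@qpair_coset_le f) M (row_mx k (k *m M)) W0 WD.
    rewrite (eq_bigr (fun h => q f (h + k) ((h + k) *m M))) => [|h _]; last first.
      by rewrite add_row_mx qpair_row mulmxDl.
    by rewrite [X in _ <= X -> _](eq_bigr (fun h => q f h (h *m M))) => [|h _]; rewrite ?qpair_row.
  rewrite sumr_const -[SW *+ _]mulr_natl card_V exchange_big /=; apply: le_trans.
  rewrite (eq_bigr (fun=> S)) => [|h _]; first by rewrite sumr_const -[S *+ _]mulr_natl.
  by rewrite [RHS](reindex_inj (addrI h)).
have N0 := N_gt0.
apply: (@le_trans _ _ SW); last first.
  rewrite /SW [leRHS](bigID (mem W)) /=.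
  rewrite [X in _ <= X + _](eq_bigl (mem W)) => [|h].
    by rewrite lerDl; apply: sumr_ge0 => h _; exact: q_ge0.
  by apply: andb_idl => hW; rewrite hB.
rewrite -(ler_pM2l N0); apply: le_trans avg.
apply: (@le_trans _ _ (d ^+ 4 * N / 2 * (d * N))).
  by rewrite le_eqVlt; apply/orP; left; apply/eqP; field.
apply: ler_pM => //; rewrite ?mulr_ge0 ?exprn_ge0 ?(ltW N0) //; lra.
Qed.

(** The phase of [g] turns its derivative along an admissible [h] into [Delta f h] times the
    character of [h M], up to a constant sign, so [nsq (corr g h)] equals the value of [q] at
    [(h, h M)]. By [corr_l2] the fourth powers of the Fourier coefficients of [g] then sum to at
    least [c]; by Parseval this sum is at most the largest squared modulus. *)
Lemma quadratic_correlation f (M B : 'M['F_2]_n) c : bounded1 f ->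
  c * N <= \sum_(h | h *m (B + B^T) == h *m M) q f h (h *m M) ->
  exists xi : V, c <= nsq ((2 ^+ n)^-1 * \sum_x f x * sgn C (dot (x *m B) x + dot x xi)).
Proof.
move=> fb hc.
pose g x := f x * sgn C (dot (x *m B) x).
have gb : bounded1 g.
  move=> x; rewrite /g normrM (_ : `|sgn C _| = 1) ?mulr1; first exact: fb.
  by case: (sgnP C (dot (x *m B) x)) => ->; rewrite ?normrN normr1.
have Dg h x : h *m (B + B^T) = h *m M ->
    Delta g h x = sgn C (dot (h *m B) h) * (Delta f h x * sgn C (dot x (h *m M))).
  move=> hM; rewrite /Delta /g rmorphM /= sgn_conj.
  have -> : sgn C (dot ((x + h) *m B) (x + h)) =
     sgn C (dot (x *m B) x) * sgn C (dot x (h *m M)) * sgn C (dot (h *m B) h).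
    rewrite -!sgnD; congr sgn; rewrite mulmxDl dotDl !dotDr -hM mulmxDr dotDr.
    by rewrite (dotC (h *m B) x) (dot_mul B x h); ring.
  have e := sgn_sq C (dot (x *m B) x).
  transitivity (f (x + h) * (f x)^* * (sgn C (dot (x *m B) x) * sgn C (dot (x *m B) x)) *
     sgn C (dot x (h *m M)) * sgn C (dot (h *m B) h)); first by ring.
  by rewrite e; ring.
have cg h : nsq (corr g h) = nsq (ft (Delta g h) 0).
  rewrite -nsq_conj /corr /ft rmorphM fmorphV rmorphXn rmorph_nat rmorph_sum /=.
  congr (nsq (_ * _)); apply: eq_bigr => x _.
  by rewrite dotx0 sgn0 mulr1 rmorphM /= conjCK mulrC.
have qg h : h *m (B + B^T) = h *m M -> nsq (corr g h) = q f h (h *m M).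
  move=> hM; rewrite cg /q /ft !nsqM; congr (_ * _).
  rewrite (eq_bigr (fun x => sgn C (dot (h *m B) h) * (Delta f h x * sgn C (dot x (h *m M))))).
    by rewrite -mulr_sumr nsqM nsq_sgn mul1r.
  by move=> x _; rewrite Dg // dotx0 sgn0 mulr1.
have N0 := N_gt0.
have h4 : c <= \sum_xi nsq (ft g xi) ^+ 2.
  rewrite -(ler_pM2l N0) -corr_l2 mulrC; apply: le_trans hc _.
  rewrite [leRHS](bigID (fun h => h *m (B + B^T) == h *m M)) /=.
  apply: (@le_trans _ _ (\sum_(h | h *m (B + B^T) == h *m M) nsq (corr g h))).
    by apply: ler_sum => h /eqP hM; rewrite qg.
  by rewrite lerDl; apply: sumr_ge0 => h _; exact: nsq_ge0.
have [xi _ xmax] := @arg_maxP _ R V 0 xpredT (fun xi => nsq (ft g xi)) isT.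
exists xi.
have -> : \sum_x f x * sgn C (dot (x *m B) x + dot x xi) = \sum_x g x * sgn C (dot x xi).
  by apply: eq_bigr => x _; rewrite /g sgnD mulrA.
rewrite -/(ft g xi); apply: (le_trans h4).
apply: (@le_trans _ _ (\sum_z nsq (ft g xi) * nsq (ft g z))).
  by apply: ler_sum => z _; rewrite expr2 ler_wpM2r ?nsq_ge0 //; exact: xmax.
by rewrite -mulr_sumr -[leRHS]mulr1 ler_wpM2l ?nsq_ge0 // parseval_le1.
Qed.

End Inverse.

Theorem corollary1p6 (R : realType) :
  exists (C5 c : R), 0 < C5 /\ 0 < c /\
  forall (n : nat) (K : R) (f : 'rV['F_2]_n -> R[i]),
    (0 < n)%N -> 0 < K -> bounded1 f -> 1 / K <= gowersU3_norm f ->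
    exists P : 'rV['F_2]_n -> 'F_2,
      quadratic_polynomial P /\
      (c * K `^ (- C5))%:C <=
        `| (2 ^+ n)^-1 * \sum_(x : 'rV['F_2]_n) f x * (-1) ^+ P x |.
Proof.
(* The squared correlation is at least [d^5 / 2], where [d] is [e / 64] to the power [3 * 2652] and
   [e] is the eighth power of the norm. After the square root the exponent is
   [5 * 3 * 8 / 2 * 2652], and the remaining factors make up [c]. *)
pose C5 : R := 60 * 2652.
pose c : R := expR (- ((15 * 2652 * ln 64 + ln 2) / 2)).
exists C5, c; split; [rewrite /C5; lra|split; first exact: expR_gt0].
move=> n K f n0 K0 fb hK.
pose u := gowersU3_norm f.
have u0 : 0 < u by apply: lt_le_trans hK; rewrite divr_gt0.
pose e := u ^+ 8.
have e0 : 0 < e by exact: exprn_gt0.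
have he : e * 2 ^+ n <= \sum_g qpair f g ^+ 2.
  rewrite le_eqVlt; apply/orP; left; apply/eqP; apply: (@complexI R).
  rewrite sum_row_mx.
  under [in RHS]eq_bigr do under eq_bigr do rewrite qpair_row.
  have N2 : ((2 ^+ n)%:C : R[i]) = 2 ^+ n by rewrite rmorphXn rmorph_nat.
  by rewrite q_sq rmorphM /= N2 -gowersU3_normX8 mulrC.
have [M hM] := exists_linear fb e0 he.
set d := expR _ in hM; have d0 : 0 < d by exact: expR_gt0.
have [B hB] := isotropic fb (ltW d0) hM.
have d5 : 0 < d ^+ 5 / 2 by rewrite divr_gt0 // exprn_gt0.
have [xi hxi] := quadratic_correlation fb hB.
exists (fun x => dot (x *m B) x + dot x xi); split; first exact: QuadraticPolynomial.quadratic_polynomialP.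
set z := _ * \sum_x _; rewrite -/z in hxi.
have p0 : 0 < c * K `^ (- C5) by rewrite mulr_gt0 ?expR_gt0 ?powR_gt0.
have p0' : 0 <= (c * K `^ (- C5))%:C :> R[i] by rewrite ler0c ltW.
rewrite -(@ler_pXn2r _ 2) ?nnegrE // -nsq_norm -rmorphXn lecR.
apply: le_trans hxi.
rewrite -ler_ln ?posrE ?exprn_gt0 // lnXn // lnM ?posrE ?expR_gt0 ?powR_gt0 //.
rewrite expRK ln_powR ln_div ?posrE ?exprn_gt0 // lnXn // expRK.
have lu : - ln K <= ln u.
  by rewrite -lnV ?posrE // ler_ln ?posrE ?invr_gt0 // -div1r.
rewrite ln_div ?posrE // /e lnXn // /C5; lra.
Qed.
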